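(* Let $k$ be a positive integer, let $\Lambda\subset\mathbb{R}^p$ be a precompact set of positive Lebesgue measure, let $\Lambda$ and $\mathcal{D}_i\subset\mathbb{R}^{d_i}$ ($1\le i\le k$) be separable, complete metric spaces with their Borel $\sigma$-algebras, let $\phi_i:\Lambda\to\mathcal{D}_i$ be measurable, let $P_{\text{obs},i}$ be a probability measure on $\mathcal{D}_i$ for each $i$, and let $P^0=P_{\text{init}}$ be the uniform probability measure on $\Lambda$. Let $$\mathbb{P}=\bigcap_{i=1}^k\{P \text{ a probability measure on }\Lambda\,:\,P\ll P_{\text{init}},\ P\circ\phi_i^{-1}=P_{\text{obs},i}\}.$$ Suppose there exists at least one $P\in\mathbb{P}$ with $P\ll P^0$ and $\inf_{P\in\mathbb{P}}KL(P\,\|\,P^0)<\infty$, and suppose there exists a constant $C$ such that for every $1\le i\le k$, $\frac1C\le\frac{dP_{\text{obs},i}}{dQ^0_i}\le C$ (almost everywhere), where $Q^0_i:=P^0\circ\phi_i^{-1}$. Let $P^\infty$ be the total variation limit of the iterative DCI sequence $(P^n)_{n\ge0}$ started at $P^0$ (defined in the context). Then $P^\infty$ has the maximal entropy compared to any other $P\in\mathbb{P}$; that is, $P^\infty\in\mathbb{P}$ and $h(P^\infty)\ge h(P)$ for all $P\in\mathbb{P}$.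
   Context: Iterative DCI sequence: $P^0=P_{\text{init}}$. For $n\ge1$, let $i\in\{1,\dots,k\}$ be the index with $n\equiv i\pmod k$. Let $Q^{n-1}_i:=P^{n-1}\circ\phi_i^{-1}$ and let $\{P^{n-1}_{\omega,i}\}_{\omega\in\mathcal{D}_i}$ be the disintegration of $P^{n-1}$ through $\phi_i$: the $Q^{n-1}_i$-a.e. unique measurable family of probability measures on $\Lambda$, with $P^{n-1}_{\omega,i}$ concentrated on $\phi_i^{-1}(\omega)$ for $Q_i^{n-1}$-a.e. $\omega$, such that $P^{n-1}(\cdot)=\int_{\mathcal{D}_i}P^{n-1}_{\omega,i}(\cdot)\,dQ^{n-1}_i(\omega)$. Then $P^n(\cdot):=\int_{\mathcal{D}_i}P^{n-1}_{\omega,i}(\cdot)\,dP_{\text{obs},i}(\omega)$. Known fact under these hypotheses (the convergence theorem for the sequence): $P^n$ converges in total variation to $P^\infty\in\mathbb{P}$, and $P^\infty=\operatorname{arg\,min}_{P\in\mathbb{P}}KL(P\,\|\,P^0)$. $KL(P\,\|\,Q)=\int\log\frac{dP}{dQ}\,dP$ for $P\ll Q$ is the Kullback–Leibler divergence. For $P$ with Lebesgue density $p$ on $\Lambda$, $h(P)=-\int_\Lambda p\log p\,d\lambda\in[-\infty,\infty)$ is the (differential) entropy. The uniform measure is normalized Lebesgue measure on $\Lambda$. *)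

(* Defs.v *)
From HB Require Import structures.
From mathcomp Require Import all_boot all_order all_algebra.
From mathcomp Require Import all_classical all_reals all_analysis.
From mathcomp Require Import measurable_realfun.

Set Implicit Arguments.
Unset Strict Implicit.
Unset Printing Implicit Defensive.
Import Order.TTheory GRing.Theory Num.Theory.
Import numFieldNormedType.Exports.
Local Open Scope classical_set_scope.
Local Open Scope ring_scope.

(* [X] with its Borel sigma-algebra. Measurable types carry a distinguished
   point in this library, hence the argument [x0], which plays no other role. *)
Definition borel (X : topologicalType) (x0 : X) : Type := X.

Section borel_instance.
Variables (X : topologicalType) (x0 : X).

HB.instance Definition _ := Choice.on (borel x0).
HB.instance Definition _ := isPointed.Build (borel x0) x0.

Let borel_setC (A : set X) : <<s @open X >> A -> <<s @open X >> (~` A).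
Proof. by move=> oA; rewrite -setTD; exact: sigma_algebraCD. Qed.

HB.instance Definition _ := @isMeasurable.Build (sigma_display (@open X))
  (borel x0) <<s @open X >> (@sigma_algebra0 _ setT _) borel_setC
  (@sigma_algebra_bigcup _ setT _).

End borel_instance.

Definition Rn (R : realType) (n : nat) := borel (0 : 'rV[R]_n).

Lemma sigma_finite_pushforward d1 d2 (T1 : measurableType d1)
    (T2 : measurableType d2) (R : realType) (mu : set T1 -> \bar R)
    (f : T1 -> T2) (g : T2 -> T1) :
  measurable_fun setT g -> cancel f g ->
  sigma_finite setT mu -> sigma_finite setT (pushforward mu f).
Proof.
move=> mg fK [F TF Foo].
exists (fun k => g @^-1` F k); first by rewrite -preimage_bigcup -TF preimage_setT.
move=> k; have [mF Fk] := Foo k; split.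
  by rewrite -[X in measurable X]setTI; exact: mg.
by rewrite /pushforward -comp_preimage (_ : g \o f = id)//; apply/funext.
Qed.

Lemma sigma_finite_product d1 d2 (T1 : measurableType d1)
    (T2 : measurableType d2) (R : realType)
    (m1 : {sigma_finite_measure set T1 -> \bar R})
    (m2 : {sigma_finite_measure set T2 -> \bar R}) :
  sigma_finite setT (m1 \x m2)%E.
Proof.
have /sigma_finiteP[F [TF ndF Foo]] := sigma_finiteT m1.
have /sigma_finiteP[G [TG ndG Goo]] := sigma_finiteT m2.
exists (fun n => F n `*` G n).
  rewrite -setXTT TF TG predeqE => -[x y]; split.
    move=> [/= [n _ Fnx] [k _ Gky]]; exists (maxn n k) => //; split.
    - by move: x Fnx; exact/subsetPset/ndF/leq_maxl.
    - by move: y Gky; exact/subsetPset/ndG/leq_maxr.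
  by move=> [n _ []/= ? ?]; split; exists n.
move=> k; have [? ?] := Foo k; have [? ?] := Goo k.
split; first exact: measurableX.
by rewrite product_measure1E// lte_mul_pinfty// ge0_fin_numE.
Qed.

Section lebesgue_tuple.
Context {R : realType}.
Local Notation TR := (measurableTypeR R).

Definition tcons n (x : TR * n.-tuple TR) : n.+1.-tuple TR :=
  [tuple of x.1 :: x.2].

Lemma measurable_tcons n : measurable_fun setT (@tcons n).
Proof. by apply: (@measurable_cons _ _ _ _ fst n snd). Qed.

Section step.
Variables (n : nat) (mu : {sigma_finite_measure set (n.-tuple TR) -> \bar R}).

Definition lebesgue_tuple_step : set (n.+1.-tuple TR) -> \bar R :=
  pushforward (lebesgue_measure \x mu)%E (@tcons n).

Let m : {measure set (n.+1.-tuple TR) -> \bar R} :=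
  measure_function_pushforward__canonical__measure_function_Measure
     (lebesgue_measure \x mu)%E (@measurable_tcons n).

HB.instance Definition _ := isMeasure.Build _ _ _ lebesgue_tuple_step
  (measure0 m) (measure_ge0 m) (@measure_semi_sigma_additive _ _ _ m).

Let step_sigma_finite : sigma_finite setT lebesgue_tuple_step.
Proof.
pose u (t : n.+1.-tuple TR) : TR * n.-tuple TR := (thead t, [tuple of behead t]).
apply: (@sigma_finite_pushforward _ _ _ _ _ _ (@tcons n) u).
- apply: measurable_fun_pair; first exact: measurable_tnth.
  exact: measurable_behead.
- by case=> x v; rewrite /u /tcons /= theadE; congr pair; apply/val_inj.
- exact: sigma_finite_product.
Qed.

HB.instance Definition _ :=
  Measure_isSigmaFinite.Build _ _ _ lebesgue_tuple_step step_sigma_finite.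

End step.

Fixpoint lebesgue_tuple n : {sigma_finite_measure set (n.-tuple TR) -> \bar R} :=
  match n with
  | 0 => \d_[tuple]
  | n'.+1 => lebesgue_tuple_step (lebesgue_tuple n')
  end.

Lemma lebesgue_tuple_box n (A : 'I_n -> set TR) :
  (forall i, measurable (A i)) ->
  lebesgue_tuple n [set t | forall i, A i (tnth t i)] =
  (\prod_(i < n) lebesgue_measure (A i))%E.
Proof.
elim: n A => [|n IHn] A mA /=.
  by rewrite big_ord0 diracE mem_set// => -[].
rewrite big_ord_recl -IHn//.
pose B := [set t : n.-tuple TR | forall i, A (lift ord0 i) (tnth t i)].
have mB : measurable B.
  rewrite (_ : B = \bigcap_i ((fun t => tnth t i) @^-1` A (lift ord0 i))).
    apply: fin_bigcap_measurable => // i _; rewrite -[X in measurable X]setTI.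
    exact: measurable_tnth.
  by apply/seteqP; split=> [t Bt i _ /=|t Bt i /=]; exact: Bt.
rewrite -[RHS](@product_measure1E _ _ _ _ _ lebesgue_measure)//.
congr ((lebesgue_measure \x lebesgue_tuple n)%E _).
apply/seteqP; split=> -[x t] /=.
  move=> H; split=> [|i]; first exact: (H ord0).
  by have := H (lift ord0 i); rewrite tnthS.
by move=> [A0 H] i; case: (unliftP ord0 i) => [j ->|->]; rewrite ?tnthS.
Qed.

End lebesgue_tuple.

Section lebesgue_Rn.
Context {R : realType} (n : nat).
Local Notation TR := (measurableTypeR R).

Definition row_of_tuple (t : n.-tuple TR) : Rn R n := \row_i tnth t i.
Definition tuple_of_row (x : Rn R n) : n.-tuple TR :=
  [tuple (x : 'rV[R]_n) ord0 i | i < n].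

Lemma row_of_tupleK : cancel row_of_tuple tuple_of_row.
Proof. by move=> t; apply: eq_from_tnth => i; rewrite tnth_mktuple mxE. Qed.

Lemma measurable_tuple_of_row : measurable_fun setT tuple_of_row.
Proof.
apply/measurable_fun_tnthP => i.
rewrite (_ : _ \o _ = fun x : Rn R n => (x : 'rV[R]_n) ord0 i); last first.
  by apply/funext => x /=; rewrite tnth_mktuple.
apply: (measurability _ (RGenOInfty.measurableE R)).
move=> _ [_ [a ->] <-]; rewrite setTI; apply: sub_sigma_algebra.
apply: (@open_comp _ _ (fun x : 'rV[R]_n => x ord0 i)); last exact: interval_open.
by move=> x _; exact: coord_continuous.
Qed.

Lemma measurable_row_of_tuple : measurable_fun setT row_of_tuple.
Proof.
apply: (@measurability _ _ _ (Rn R n) setT row_of_tuple (@open 'rV[R]_n) erefl).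
move=> _ [U oU <-]; rewrite setTI.
pose B (q : 'rV[rat]_n * nat) : set 'rV[R]_n :=
  [set x | forall i, ball (ratr (q.1 ord0 i) : R) q.2.+1%:R^-1 (x ord0 i)].
have -> : U = \bigcup_(q in [set q | B q `<=` U]) B q.
  apply/seteqP; split=> [x Ux|x [q /= qU Bqx]]; last exact: qU.
  have /nbhs_ballP[_/posnumP[e] eU] : nbhs x U by exact: open_nbhs_nbhs.
  pose m := (Num.truncn (2 / e%:num)).
  have me : m.+1%:R^-1 < e%:num / 2 :> R.
    by rewrite -[ltRHS]invrK ltf_pV2 ?posrE ?invr_gt0// invf_div truncnS_gt.
  have /(_ _)/cid qx i : exists q : rat, ball (ratr q : R) m.+1%:R^-1 (x ord0 i).
    have : x ord0 i - m.+1%:R^-1 < x ord0 i + m.+1%:R^-1.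
      by rewrite ltrBlDr -addrA ltrDl addr_gt0.
    move=> /rat_in_itvoo[q]; rewrite in_itv/= => /andP[q1 q2].
    by exists q; rewrite /ball/= ltr_distl q1 q2.
  exists (\row_i sval (qx i), m); last by move=> i /=; rewrite mxE; exact: (svalP (qx i)).
  move=> y /= By; apply: eU; split=> // i j; rewrite (ord1 i).
  rewrite [e%:num]splitr.
  apply: (@ball_triangle _ _ (ratr (sval (qx j)) : R)).
    by apply/ball_sym; apply: le_ball (svalP (qx j)); exact: ltW.
  by apply: (le_ball (ltW me)); have := By j; rewrite mxE.
rewrite preimage_bigcup bigcup_mkcond.
apply: countable_bigcupT_measurable => [|q]; first exact: countableP.
case: ifPn => // _.
have -> : row_of_tuple @^-1` B q = \bigcap_i ((fun t => tnth t i) @^-1`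
    (ball (ratr (q.1 ord0 i) : R) q.2.+1%:R^-1)).
  apply/seteqP; split=> [t Bt i _ /=|t Bt i /=]; first by have := Bt i; rewrite mxE.
  by rewrite mxE; exact: Bt.
apply: fin_bigcap_measurable => // i _; rewrite -[X in measurable X]setTI.
by apply: measurable_tnth => //; exact: (open_measurable (ball_open _ _)).
Qed.

(* Lebesgue measure on the Borel sets of R^n: the n-fold product of the Lebesgue
   measure of R, transported from tuples to row vectors; see [lebesgue_Rn_box]. *)
Definition lebesgue_Rn : set (Rn R n) -> \bar R :=
  pushforward (@lebesgue_tuple R n) row_of_tuple.

Let m : {measure set (Rn R n) -> \bar R} :=
  measure_function_pushforward__canonical__measure_function_Measure
    (@lebesgue_tuple R n) measurable_row_of_tuple.

HB.instance Definition _ := isMeasure.Build _ _ _ lebesgue_Rn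
  (measure0 m) (measure_ge0 m) (@measure_semi_sigma_additive _ _ _ m).

Lemma lebesgue_Rn_box (A : 'I_n -> set R) :
  (forall i, measurable (A i)) ->
  lebesgue_Rn [set x : 'rV[R]_n | forall i, A i (x ord0 i)] =
  (\prod_(i < n) lebesgue_measure (A i))%E.
Proof.
move=> mA; rewrite -lebesgue_tuple_box//; congr (lebesgue_tuple n _).
by apply/seteqP; split=> t /= H i; have := H i; rewrite mxE.
Qed.

Let lebesgue_Rn_sigma_finite : sigma_finite setT lebesgue_Rn.
Proof.
apply: sigma_finite_pushforward measurable_tuple_of_row row_of_tupleK _.
exact: sigma_finiteT.
Qed.

HB.instance Definition _ :=
  Measure_isSigmaFinite.Build _ _ _ lebesgue_Rn lebesgue_Rn_sigma_finite.

End lebesgue_Rn.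

Section lebesgue_sub.
Context {R : realType} (n : nat) (A : set 'rV[R]_n) (a : A).
Hypothesis mA : measurable (A : set (Rn R n)).

Lemma measurable_set_val_preimage (C : set (Rn R n)) :
  measurable C -> measurable (set_val @^-1` C : set (borel a)).
Proof.
have : sigma_algebra setT
    [set D : set 'rV[R]_n | measurable (set_val @^-1` D : set (borel a))].
  split=> [|D mD|F mF] /=; first by rewrite preimage_set0; exact: measurable0.
    by rewrite setTD preimage_setC; exact: (@measurableC _ (borel a)).
  by rewrite preimage_bigcup; exact: (@bigcupT_measurable _ (borel a)).
move=> sA; move: C; apply: smallest_sub => // V oV.
by apply: sub_sigma_algebra; exists V.
Qed.

Lemma measurable_set_val_image (B : set (borel a)) :
  measurable B -> measurable (set_val @` B : set (Rn R n)).
Proof.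
move=> mB.
have [C [mC ->]] : exists C : set (Rn R n), measurable C /\ B = set_val @^-1` C.
  have : preimage_set_system setT (set_val : A -> 'rV[R]_n)
      <<s @open 'rV[R]_n >> B.
    move: B mB; apply: smallest_sub.
      exact/sigma_algebra_preimage/smallest_sigma_algebra.
    move=> _ [V oV <-]; exists V; first exact: sub_sigma_algebra.
    by rewrite setTI.
  by move=> [C mC <-]; exists C; split=> //; rewrite setTI.
rewrite (_ : _ @` _ = C `&` A); first exact: measurableI.
apply/seteqP; split=> [_ [x Cx <-]|x [Cx Ax]]; first by split=> //; exact: set_valP.
by exists (SigSub (mem_set Ax)).
Qed.

(* Lebesgue measure of R^n restricted to [A], as a measure on the space [A]. *)
Definition lebesgue_sub (_ : measurable (A : set (Rn R n))) : set (borel a) -> \bar R :=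
  fun B => lebesgue_Rn (set_val @` B : set (Rn R n)).

Let sub0 : lebesgue_sub mA set0 = 0%E.
Proof. by rewrite /lebesgue_sub image_set0 measure0. Qed.

Let sub_ge0 B : (0 <= lebesgue_sub mA B)%E.
Proof. exact: measure_ge0. Qed.

Let sub_sigma : semi_sigma_additive (lebesgue_sub mA).
Proof.
move=> F mF tF mUF; rewrite /lebesgue_sub image_bigcup.
apply: measure_semi_sigma_additive.
- by move=> k; exact: measurable_set_val_image.
- apply/trivIsetP => i j _ _ ij; rewrite -subset0 => _ [[y Fy <-]].
  move=> [z Fz /val_inj zy]; rewrite zy in Fz.
  move/trivIsetP : tF => /(_ _ _ I I ij)/seteqP[+ _].
  by move=> /(_ y); apply.
- by rewrite -image_bigcup; exact: measurable_set_val_image.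
Qed.

HB.instance Definition _ :=
  isMeasure.Build _ _ _ (lebesgue_sub mA) sub0 sub_ge0 sub_sigma.

Let sub_sigma_finite : sigma_finite setT (lebesgue_sub mA).
Proof.
have [F TF Foo] := sigma_finiteT (@lebesgue_Rn R n).
exists (fun k => set_val @^-1` F k); first by rewrite -preimage_bigcup -TF preimage_setT.
move=> k; have [mF Fk] := Foo k.
have mpF : measurable (set_val @^-1` F k : set (borel a)).
  exact: measurable_set_val_preimage.
split => //; apply: le_lt_trans Fk.
apply: le_measure; rewrite ?inE//; first exact: measurable_set_val_image.
by move=> _ [x Fx <-].
Qed.

HB.instance Definition _ :=
  Measure_isSigmaFinite.Build _ _ _ (lebesgue_sub mA) sub_sigma_finite.

End lebesgue_sub.
Arguments lebesgue_sub {R n A} a mA _.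

(* The metric is only required to induce the topology of [X]; when [X] is a
   subset of R^n, the restriction of the metric of R^n is one possibility. *)
Definition separable_complete_metric (R : realType) (X : topologicalType) : Prop :=
  (exists S : set X, countable S /\ dense S) /\
  exists dist : X -> X -> R,
  [/\ (forall x y, 0 <= dist x y /\ (dist x y = 0 <-> x = y)),
      (forall x y, dist x y = dist y x),
      (forall x y z, dist x z <= dist x y + dist y z),
      (forall x (A : set X), nbhs x A <->
         exists2 e : R, 0 < e & [set y | dist x y < e] `<=` A) &
      (forall u : nat -> X,
         (forall e : R, 0 < e -> exists N, forall m n, (N <= m)%N -> (N <= n)%N ->
            dist (u m) (u n) < e) ->
         exists l : X, u n @[n --> \oo] --> l)].

Section probability_notions.
Context (R : realType) d (T : measurableType d).
Implicit Types P Q : probability T R.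

(* dP/dmu; unspecified unless P `<< mu *)
Definition RN P (mu : {sigma_finite_measure set T -> \bar R}) (x : T) : R :=
  fine (Radon_Nikodym (charge_of_finite_measure P) mu x).

Definition KL P Q : \bar R :=
  if `[< P `<< Q >] then (\int[P]_x (ln (RN P Q x))%:E)%E else +oo%E.

(* h(P) = - \int p log p dmu with p = dP/dmu, for P `<< mu; MathComp's
   convention ln 0 = 0 yields 0 log 0 = 0. *)
Definition entropy (mu : {sigma_finite_measure set T -> \bar R}) P : \bar R :=
  (- \int[mu]_x (RN P mu x * ln (RN P mu x))%:E)%E.

Definition tv_dist P Q : \bar R :=
  ereal_sup [set `|P A - Q A|%E | A in measurable].

Definition tv_cvg (P : nat -> probability T R) Q : Prop :=
  tv_dist (P n) Q @[n --> \oo] --> 0%E.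

Context d' (U : measurableType d').
Implicit Type phi : {mfun T >-> U}.

Definition is_uniform (mu : set T -> \bar R) P : Prop :=
  forall A, measurable A -> P A = (mu A * ((fine (mu setT))^-1)%:E)%E.

Definition is_disintegration P phi (kappa : R.-pker U ~> T) : Prop :=
  {ae distribution P phi, forall w, kappa w (phi @^-1` [set w]) = 1%E} /\
  forall A, measurable A -> P A = (\int[distribution P phi]_w kappa w A)%E.

(* The disintegration is unique up to a null set of the distribution of phi
   under P. Along a DCI sequence with Pobs equivalent to the initial push-forward
   these null sets are Pobs-null, so the choice of kappa does not affect P'. *)
Definition DCI_step phi (Pobs : probability U R) P P' : Prop :=
  exists kappa : R.-pker U ~> T, is_disintegration P phi kappa /\
    forall A, measurable A -> P' A = (\int[Pobs]_w kappa w A)%E.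

End probability_notions.

Section problem.
Context (R : realType) d (T : measurableType d) (k : nat).
Context (d' : 'I_k -> measure_display) (U : forall i, measurableType (d' i)).
Context (phi : forall i, {mfun T >-> U i}) (Pobs : forall i, probability (U i) R).

Definition feasible (P0 : probability T R) : set (probability T R) :=
  \bigcap_(i in [set: 'I_k]) [set P : probability T R | P `<< P0 /\
    forall B : set (U i), measurable B -> distribution P (phi i) B = Pobs i B].

(* The maps are indexed from 0, so step n.+1 uses the index i with
   i = n modulo k. *)
Definition DCI_sequence (P0 : probability T R) (P : nat -> probability T R) : Prop :=
  P 0%N = P0 /\
  forall n (i : 'I_k), n = i %[mod k] -> DCI_step (phi i) (Pobs i) (P n) (P n.+1).

(* 1/C <= dPobs_i/dQ_i <= C a.e., where Q_i is the push-forward of P0 by phi_i;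
   absolute continuity is what makes the derivative meaningful. *)
Definition bounded_ratios (P0 : probability T R) : Prop :=
  exists C : R, forall i, Pobs i `<< distribution P0 (phi i) /\
    {ae distribution P0 (phi i),
      forall w, C^-1 <= RN (Pobs i) (distribution P0 (phi i)) w <= C}.

End problem.

(* Main.v *)
(* Since P0 is uniform, maximizing the entropy amounts to minimizing
   KL(. | P0).  Write l_n = ln (dP^(n+1)/dP^n), a function of the component of
   phi fitted at step n and bounded for each n, p_n = exp (l_0 + ... + l_(n-1))
   for the density of P^n, and a_n = KL(P^(n+1) | P^n) = int l_n dP^(n+1).  As l_n
   only depends on a fitted marginal, int l_n dQ = a_n for every feasible Q, so
   a_0 + ... + a_(n-1) = int ln p_n dQ <= KL(Q | P0).

   For the limit to attain this bound one needs KL(Pinf | P0) <= sum_n a_n, which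
   is delicate because ln p_n is not uniformly bounded.  Let rho be the minimum
   of the densities p_N, ..., p_(N+k).  For each j < N some p_m in this window has
   the marginal fitted at step j, and rho <= p_m, so only the negative part of
   l_j contributes to the error:
     int l_j rho <= int l_j p_m + int l_j^- (p_m - rho)
                 <= a_j + O(sqrt a_j * sqrt (a_N + ... + a_(N+k-1))),
   because both int (l_j^-)^2 p_m and the squared Hellinger distance of P^(j+1)
   and P^j are O(a_j).  Summing over j < N, the error is small along a
   subsequence since sum_n a_n is finite and the harmonic series diverges.  As
   rho tends to dPinf/dP0 in L^1, Fatou's lemma concludes. *)

Require Import Defs.
From HB Require Import structures.
From mathcomp Require Import all_boot all_order all_algebra.
From mathcomp Require Import all_classical all_reals all_analysis.
From mathcomp Require Import measurable_realfun ring lra.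

Set Implicit Arguments.
Unset Strict Implicit.
Unset Printing Implicit Defensive.
Import Order.TTheory GRing.Theory Num.Theory.
Import numFieldNormedType.Exports.
Local Open Scope classical_set_scope.
Local Open Scope ring_scope.

(** * Densities *)

Section density.
Context (R : realType) d (T : measurableType d).

Definition is_density (mu nu : set T -> \bar R) (f : T -> R) : Prop :=
  [/\ measurable_fun setT f, forall x, 0 <= f x &
      forall A, measurable A -> nu A = (\int[mu]_(x in A) (f x)%:E)%E].

Variables (mu : {sigma_finite_measure set T -> \bar R})
          (nu : {finite_measure set T -> \bar R}) (f : T -> R).
Hypothesis fd : is_density mu nu f.

Lemma density_dominates : nu `<< mu.
Proof.
case: fd => mf f0 fE; apply/null_content_dominatesP => A mA muA.
rewrite fE//; apply: null_set_integral => //.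
  exact/measurable_EFinP/measurable_funTS.
Qed.

Lemma density_integrable : mu.-integrable setT (EFin \o f).
Proof.
case: fd => mf f0 fE; apply/integrableP; split; first exact/measurable_EFinP.
under eq_integral do rewrite gee0_abs ?lee_fin//.
by rewrite -fE// ltey_eq fin_num_measure.
Qed.

(** The change of variables is available for the Radon-Nikodym derivative, which agrees with [f]
    almost everywhere because both have the same integral over every measurable set. *)
Lemma ge0_integral_density (g : T -> \bar R) :
  measurable_fun setT g -> (forall x, 0 <= g x)%E ->
  (\int[nu]_x g x = \int[mu]_x (g x * (f x)%:E))%E.
Proof.
move=> mg g0; have numu := density_dominates; case: fd => mf f0 fE.
rewrite -(Radon_Nikodym_SigmaFinite.change_of_variables numu)//.
have mRN : measurable_fun setT (Radon_Nikodym_SigmaFinite.f nu mu).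
  by apply: measurable_int; exact: Radon_Nikodym_SigmaFinite.f_integrable.
apply: ae_eq_integral => //.
- exact: emeasurable_funM.
- by apply: emeasurable_funM => //; exact/measurable_EFinP.
apply: ae_eqe_mul2l; apply/ae_eq_sym; apply: integral_ae_eq => //.
  exact: density_integrable.
by move=> E _ mE; rewrite -Radon_Nikodym_SigmaFinite.f_integral// -fE.
Qed.

Lemma integral_density (g : T -> R) :
  measurable_fun setT g -> 
  (\int[nu]_x (g x)%:E = \int[mu]_x (g x * f x)%:E)%E.
Proof.
move=> mg; case: fd => mf f0 fE; rewrite integralE [RHS]integralE.
have /measurable_EFinP mg' := mg.
rewrite (ge0_integral_density (measurable_funepos mg'))//.
rewrite (ge0_integral_density (measurable_funeneg mg'))//.
congr (_ - _)%E; apply: eq_integral => x _.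
- by rewrite !funeposE -!EFin_max -EFinM maxr_pMl// mul0r.
- by rewrite !funenegE -!EFin_max -EFinM maxr_pMl// mul0r mulNr.
Qed.

End density.

(** The hypothesis makes [P] the composition of [kappa] with the constant kernel [Q] on a one-point
    space, so this is integration against a composition of kernels. *)
Lemma integral_disintegration (R : realType) d d' (T : measurableType d)
    (U : measurableType d') (P : probability T R) (Q : probability U R)
    (kappa : R.-pker U ~> T) (F : T -> \bar R) :
  (forall A, measurable A -> P A = \int[Q]_w kappa w A)%E ->
  measurable_fun setT F -> (forall x, 0 <= F x)%E ->
  (\int[P]_x F x = \int[Q]_w \int[kappa w]_x F x)%E.
Proof.
move=> PE mF F0.
have mQ : measurable_fun [set: unit] (fun=> Q : pprobability U R).
  exact: measurable_cst.
have := @integral_kcomp _ _ _ unit U T R (kprobability mQ)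
  (kernel.kernel_snd (T0 := unit) kappa) tt F F0 mF.
rewrite /= => <-; apply: eq_measure_integral => A mA _.
by rewrite /= PE.
Qed.

(** The setwise form of [K^-1 <= dmu/dnu <= K]: it passes to push-forwards and composes without any
    choice of densities. *)
Definition comparable_measures (R : realType) d (T : measurableType d) (K : R)
    (mu nu : set T -> \bar R) : Prop :=
  forall A, measurable A -> (K^-1%:E * nu A <= mu A /\ mu A <= K%:E * nu A)%E.

(** The absolute value gives the nonnegativity everywhere that [is_density] demands, and changes the
    derivative on a null set only. *)
Lemma RN_density (R : realType) d (T : measurableType d) (P : probability T R)
    (mu : {sigma_finite_measure set T -> \bar R}) :
  P `<< mu ->
  is_density mu P (fun x => `|RN P mu x|) /\
  ae_eq mu setT (RN P mu) (fun x => `|RN P mu x|).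
Proof.
move=> Pmu; have Pmu' : charge_of_finite_measure P `<< mu := Pmu.
have mRN : measurable_fun setT (RN P mu).
  apply: measurableT_comp => //.
have ae : ae_eq mu setT (RN P mu) (fun x => `|RN P mu x|).
  have := ae_eq_Radon_Nikodym_SigmaFinite Pmu measurableT.
  apply: filterS => x /(_ I) fE _.
  by rewrite /RN -fE ger0_norm// fine_ge0// Radon_Nikodym_SigmaFinite.f_ge0.
split=> //; split=> //; first exact: measurableT_comp.
move=> A mA; rewrite -[LHS]/(charge_of_finite_measure P A).
rewrite (Radon_Nikodym_integral Pmu' mA).
apply: ae_eq_integral => //.
- apply: measurable_funTS.
  exact: measurable_int (Radon_Nikodym_integrable Pmu').
- by apply/measurable_EFinP; apply: measurable_funTS; exact: measurableT_comp.
- apply: filterS ae => x /(_ I) <- _.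
  by rewrite /RN fineK// Radon_Nikodym_fin_num.
Qed.

(** To have the bounds everywhere, a density [f] is clipped to [[K^-1, K]]. This changes no
    integral: for [B] inside [Hi], integrating [f] gives [P B >= K * Q B], and comparability forces
    equality; [Lo] is symmetric. *)
Lemma bounded_density (R : realType) d (T : measurableType d)
    (P Q : probability T R) (K : R) : 0 < K -> comparable_measures K P Q ->
  exists r, is_density Q P r /\ forall x, K^-1 <= r x <= K.
Proof.
move=> K0 PQ.
have PllQ : P `<< Q.
  apply/null_content_dominatesP => A mA QA0; have [_] := PQ A mA.
  by rewrite QA0 mule0 => ?; apply/eqP; rewrite eq_le measure_ge0 andbT.
have [[mf f0 fE] _] := RN_density PllQ.
set f := fun x => _ in mf f0 fE.
have KK : K^-1 <= K.
  have [+ +] := PQ setT measurableT.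
  by rewrite !probability_setT !mule1 !lee_fin; exact: le_trans.
pose r x := Num.min K (Num.max K^-1 (f x)).
exists r; split; last first.
  by move=> x; rewrite le_min KK ge_min lexx le_max lexx.
have mr : measurable_fun setT r.
  by apply: measurable_minr => //; exact: measurable_maxr.
have r0 x : 0 <= r x by rewrite le_min (ltW K0) le_max f0 orbT.
split=> // A mA.
have Er (g : T -> R) B : measurable_fun setT g -> measurable B ->
    measurable_fun B (EFin \o g).
  by move=> mg mB; apply/measurable_EFinP; exact: measurable_funTS.
pose Hi := [set x | K < f x]; pose Lo := [set x | f x < K^-1].
have mHi : measurable Hi.
  rewrite (_ : Hi = f @^-1` `]K, +oo[); last first.
    by apply/seteqP; split=> x /=; rewrite in_itv /= andbT.
  by rewrite -[X in measurable X]setTI; exact: mf.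
have mLo : measurable Lo.
  rewrite (_ : Lo = f @^-1` `]-oo, K^-1[); last first.
    by apply/seteqP; split=> x /=; rewrite in_itv.
  by rewrite -[X in measurable X]setTI; exact: mf.
have intC B c : measurable B -> (\int[Q]_(x in B) c%:E = c%:E * Q B)%E.
  by move=> mB; rewrite integral_cst.
have PHi B : measurable B -> B `<=` Hi -> (P B = \int[Q]_(x in B) (r x)%:E)%E.
  move=> mB BHi.
  have -> : (\int[Q]_(x in B) (r x)%:E = K%:E * Q B)%E.
    rewrite -intC//; apply: eq_integral => x /set_mem/BHi Kf; congr EFin.
    by rewrite /r; apply/min_idPl; rewrite le_max (ltW Kf) orbT.
  apply/eqP; rewrite eq_le (PQ B mB).2 /= fE// -intC//.
  apply: ge0_le_integral => //; first by move=> x _; rewrite lee_fin ltW.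
  - exact: Er.
  - by move=> x /BHi Kf; rewrite lee_fin ltW.
have PLo B : measurable B -> B `<=` Lo -> (P B = \int[Q]_(x in B) (r x)%:E)%E.
  move=> mB BLo.
  have -> : (\int[Q]_(x in B) (r x)%:E = K^-1%:E * Q B)%E.
    rewrite -intC//; apply: eq_integral => x /set_mem/BLo Kf; congr EFin.
    rewrite /r; have -> : Num.max K^-1 (f x) = K^-1 by apply/max_idPl/ltW.
    exact/min_idPr.
  apply/eqP; rewrite eq_le (PQ B mB).1 andbT fE// -intC//.
  apply: ge0_le_integral => //.
  - exact: Er.
  - by move=> x /BLo Kf; rewrite lee_fin ltW.
have Pmid B : measurable B -> B `<=` ~` (Hi `|` Lo) ->
    (P B = \int[Q]_(x in B) (r x)%:E)%E.
  move=> mB BLo; rewrite fE//; apply: eq_integral => x /set_mem/BLo.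
  move=> /= /not_orP[/negP]; rewrite -leNgt => fK /negP; rewrite -leNgt => Kf.
  congr EFin; rewrite /r; have -> : Num.max K^-1 (f x) = f x by apply/max_idPr.
  by apply/esym/min_idPr.
have mid0 : measurable (A `&` ~` (Hi `|` Lo)).
  by apply: measurableI => //; apply: measurableC; exact: measurableU.
have AE : A = (A `&` Hi) `|` ((A `&` Lo) `|` (A `&` ~` (Hi `|` Lo))).
  by rewrite -setIUr -setIUr setUA setUCr setIT.
have HL : Hi `&` Lo = set0.
  apply/seteqP; split=> // x [/= Kf fK].
  by have := lt_trans Kf fK; rewrite ltNge KK.
have d2 : (A `&` Lo) `&` (A `&` ~` (Hi `|` Lo)) = set0.
  by apply/seteqP; split=> // x [[_ ?] [_ /not_orP[]]].
have d1 : (A `&` Hi) `&` ((A `&` Lo) `|` (A `&` ~` (Hi `|` Lo))) = set0.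
  apply/seteqP; split=> // x [[_ Hx]] [[_ Lx]|[_ /not_orP[]]//].
  by have : (Hi `&` Lo) x by []; rewrite HL.
have mAH := measurableI _ _ mA mHi; have mAL := measurableI _ _ mA mLo.
have mALm := measurableU _ _ mAL mid0.
transitivity (P (A `&` Hi) + (P (A `&` Lo) + P (A `&` ~` (Hi `|` Lo))))%E.
  by rewrite {1}AE measureU// measureU.
rewrite PHi// PLo// Pmid// [in RHS]AE.
have rU E F : measurable E -> measurable F -> E `&` F = set0 ->
    (\int[Q]_(x in E `|` F) (r x)%:E =
     \int[Q]_(x in E) (r x)%:E + \int[Q]_(x in F) (r x)%:E)%E.
  move=> mE mF EF; rewrite ge0_integral_setU//.
  - by apply: Er => //; exact: measurableU.
  - by move=> x _; rewrite lee_fin.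
  - exact/disj_set2P.
by rewrite rU// rU.
Qed.

(* kappa w is carried by the fibre of w, so integrating r over a fibre against
   kappa w multiplies by r w. *)
Lemma DCI_step_density (R : realType) d d' (T : measurableType d)
    (U : measurableType d') (phi : {mfun T >-> U}) (Pobs : probability U R)
    (P P' : probability T R) (r : U -> R) :
  (forall w : U, measurable [set w]) ->
  is_density (distribution P phi) Pobs r ->
  DCI_step phi Pobs P P' -> is_density P P' (r \o phi).
Proof.
move=> mpt rd [kappa [[conc PE] P'E]].
have [mr r0 rE] := rd.
have mrphi : measurable_fun setT (r \o phi) by exact: measurableT_comp.
split=> // [x|A mA]; first exact: r0.
have mF : measurable_fun setT (fun x => (\1_A x * r (phi x))%:E).
  by apply/measurable_EFinP; apply: measurable_funM => //; exact: measurable_indic.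
have -> : (\int[P]_(x in A) ((r \o phi) x)%:E =
           \int[P]_x (\1_A x * r (phi x))%:E)%E.
  rewrite integral_mkcond; apply: eq_integral => x _.
  by rewrite patchE indicE; case: ifP => xA; rewrite ?mul1r ?mul0r.
rewrite (integral_disintegration PE mF); last first.
  by move=> x; rewrite lee_fin mulr_ge0// r0.
rewrite P'E// (ge0_integral_density rd)//; last exact: measurable_kernel.
apply: ae_eq_integral => //.
- apply: emeasurable_funM; first exact: measurable_kernel.
  exact/measurable_EFinP.
- apply: measurable_fun_integral_kernel => //.
  + by move=> B mB; exact: measurable_kernel.
  + by move=> x; rewrite lee_fin mulr_ge0// r0.
apply: filterS conc => w kw _.
have mfib : measurable (phi @^-1` [set w]).
  by rewrite -[X in measurable X]setTI; exact: (measurable_funP phi).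
transitivity (\int[kappa w]_x ((r w)%:E * (\1_A x)%:E))%E.
  rewrite ge0_integralZl//; first by rewrite integral_indic// setIT muleC.
    exact/measurable_EFinP/measurable_indic.
  by rewrite lee_fin r0.
apply: ae_eq_integral => //.
  apply: emeasurable_funM; first exact: measurable_cst.
  exact/measurable_EFinP/measurable_indic.
(* The exceptional set is the complement of the fibre, null because the fibre already carries the
   full mass 1. *)
exists (~` (phi @^-1` [set w])); split.
- exact: measurableC.
- have : (kappa w setT = kappa w (phi @^-1` [set w]) +
                         kappa w (~` (phi @^-1` [set w])))%E.
    rewrite -{1}(setUCr (phi @^-1` [set w])).
    exact: measureU mfib (measurableC mfib) (setICr _).
  rewrite prob_kernel kw; case: (kappa w _) => [x| |]// -[] x0.
  by congr EFin; lra.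
- move=> x /= xw phixw; apply: xw => _ /=; move: phixw => /= ->.
  by rewrite -EFinM mulrC.
Qed.

(** * Two-sided bounds between probability measures *)

Section comparable.
Context (R : realType) d (T : measurableType d).
Implicit Types mu nu la : probability T R.

Lemma comparable_refl mu : comparable_measures 1 mu mu.
Proof. by move=> A mA; rewrite invr1 mul1e. Qed.

Lemma comparable_sym mu nu K : 0 < K ->
  comparable_measures K mu nu -> comparable_measures K nu mu.
Proof.
move=> K0 munu A mA; have [h1 h2] := munu A mA; split.
  by rewrite muleC lee_pdivrMr// muleC.
by rewrite -lee_pdivrMl// EFinM.
Qed.

Lemma comparable_trans nu mu la K L : 0 < K -> 0 < L ->
  comparable_measures K mu nu -> comparable_measures L nu la ->
  comparable_measures (K * L) mu la.
Proof.
move=> K0 L0 munu nula A mA.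
have [h1 h2] := munu A mA; have [h3 h4] := nula A mA; split.
  apply: le_trans h1; rewrite invfM EFinM -muleA.
  by rewrite lee_pmul2l ?lte_fin ?invr_gt0.
by apply: (le_trans h2); rewrite EFinM -muleA lee_pmul2l.
Qed.

Lemma density_comparable mu nu f K : 0 < K -> is_density mu nu f ->
  {ae mu, forall x, K^-1 <= f x <= K} -> comparable_measures K nu mu.
Proof.
move=> K0 [mf f0 fE] fK A mA; rewrite fE//.
have mfA : measurable_fun A (EFin \o f).
  by apply/measurable_EFinP; exact: measurable_funTS.
split; rewrite -integral_cst//; apply: ae_ge0_le_integral => //.
- by move=> x _; rewrite lee_fin invr_ge0 ltW.
- by move=> x _; rewrite lee_fin.
- by apply: filterS fK => x /andP[Kf _] _; rewrite lee_fin.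
- by move=> x _; rewrite lee_fin.
- by move=> x _; rewrite lee_fin ltW.
- by apply: filterS fK => x /andP[_ Kf] _; rewrite lee_fin.
Qed.

End comparable.

Lemma comparable_distribution (R : realType) d d' (T : measurableType d)
    (U : measurableType d') (phi : {mfun T >-> U}) (P Q : probability T R) K :
  comparable_measures K P Q ->
  comparable_measures K (distribution P phi) (distribution Q phi).
Proof.
move=> PQ B mB; apply: PQ.
by rewrite -[X in measurable X]setTI; exact: (measurable_funP phi).
Qed.

Lemma bounded_ratios_comparable (R : realType) d (T : measurableType d) (k : nat)
    (d' : 'I_k -> measure_display) (U : forall i, measurableType (d' i))
    (phi : forall i, {mfun T >-> U i}) (Pobs : forall i, probability (U i) R)
    (P0 : probability T R) : (0 < k)%N ->
  bounded_ratios phi Pobs P0 ->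
  exists2 K, 0 < K &
    forall i, comparable_measures K (Pobs i) (distribution P0 (phi i)).
Proof.
move=> k0 [C HC].
have fd i := RN_density (HC i).1.
have aeC i : {ae distribution P0 (phi i), forall w, C^-1 <=
    `|RN (Pobs i) (distribution P0 (phi i)) w| <= C}.
  have [_ RNae] := fd i.
  by apply: filterS2 (HC i).2 RNae => w RC /(_ I) <-.
(* If [C <= 0], the density vanishes almost everywhere, although [Pobs i] has mass 1; [k0] provides
   such an index [i]. *)
have C0 : 0 < C.
  rewrite ltNge; apply/negP => C0; pose i := Ordinal k0.
  have [[mf f0 fE] _] := fd i; have := fE _ measurableT.
  rewrite probability_setT (ae_eq_integral (cst 0%E))//.
  - by rewrite integral0 => /eqP; rewrite eqe oner_eq0.
  - exact/measurable_EFinP.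
  - apply: filterS (aeC i) => w /andP[_ fC] _ /=; congr EFin.
    by apply/eqP; rewrite eq_le f0 (le_trans fC).
exists C => // i; have [fdi _] := fd i.
exact: density_comparable C0 fdi (aeC i).
Qed.

(** * Bounded density ratios of successive iterates *)

Section sequence_densities.
Context (R : realType) d (T : measurableType d) (k : nat).
Context (d' : 'I_k -> measure_display) (U : forall i, measurableType (d' i)).
Context (phi : forall i, {mfun T >-> U i}) (Pobs : forall i, probability (U i) R).
Variables (P0 : probability T R) (P : nat -> probability T R).
Hypotheses (k0 : (0 < k)%N) (mpt : forall i (w : U i), measurable [set w]).
Hypothesis bdd : bounded_ratios phi Pobs P0.
Hypothesis DCI : DCI_sequence phi Pobs P0 P.

Definition step_index n : 'I_k := Ordinal (ltn_pmod n k0).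

Let DCIn n : DCI_step (phi (step_index n)) (Pobs (step_index n)) (P n) (P n.+1).
Proof. by apply: DCI.2; rewrite /= modn_mod. Qed.

Let ratio n (L : R) : 0 < L -> comparable_measures L (P n) P0 ->
  exists r : U (step_index n) -> R, exists2 K, 0 < K &
  [/\ measurable_fun setT r, forall w, K^-1 <= r w <= K,
      is_density (distribution (P n) (phi (step_index n)))
        (Pobs (step_index n)) r &
      is_density (P n) (P n.+1) (r \o phi (step_index n))].
Proof.
move=> L0 PP0; have [C C0 HC] := bounded_ratios_comparable k0 bdd.
have CL0 : 0 < C * L by rewrite mulr_gt0.
have cmp := comparable_trans C0 L0 (HC (step_index n))
  (comparable_sym L0 (comparable_distribution (phi (step_index n)) PP0)).
have [r [rd rK]] := bounded_density CL0 cmp.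
exists r; exists (C * L) => //; split=> //; first by case: rd.
exact: DCI_step_density (@mpt _) rd (DCIn n).
Qed.

(** The constant may grow with [n]: each step multiplies it by the bound on that step's ratio. *)
Lemma DCI_comparable n : exists2 L, 0 < L & comparable_measures L (P n) P0.
Proof.
elim: n => [|n [L L0 cmp]].
  by exists 1 => //; rewrite DCI.1; exact: comparable_refl.
have [r [K K0 [_ rK _ rd]]] := ratio L0 cmp.
exists (K * L); first by rewrite mulr_gt0.
apply: (comparable_trans K0 L0 _ cmp).
by apply: density_comparable K0 rd _; apply: aeW => x; exact: rK.
Qed.

Lemma DCI_ratios : exists r : forall n, U (step_index n) -> R,
  forall n, exists2 K, 0 < K &
  [/\ measurable_fun setT (r n), forall w, K^-1 <= r n w <= K,
      is_density (distribution (P n) (phi (step_index n)))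
        (Pobs (step_index n)) (r n) &
      is_density (P n) (P n.+1) (r n \o phi (step_index n))].
Proof.
have H n := let: exist2 L L0 cmp := cid2 (DCI_comparable n) in
  cid (ratio L0 cmp).
by exists (fun n => sval (H n)) => n; exact: svalP (H n).
Qed.

End sequence_densities.

(** * Elementary inequalities *)

Section real_inequalities.
Context {R : realType}.
Implicit Types x y u l L t : R.

(** Fenchel-Young inequality for [y ln y - y + 1] and its conjugate [exp u - 1]; for [y > 0] it is
    [1 + v <= exp v] at [v = u - ln y], multiplied by [y]. *)
Lemma gibbs_ineq y u : 0 <= y -> y * u + 1 - expR u <= y * ln y - y + 1.
Proof.
rewrite le_eqVlt => /predU1P[<-|y0].
  by rewrite !mul0r; have := expR_ge0 u; lra.
have := expR_ge1Dx (u - ln y).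
rewrite expRD expRN lnK// -(ler_pM2l y0) mulrCA mulfV ?gt_eqF// mulr1; lra.
Qed.

(** With densities [exp L] and [exp (L + l)], this is the pointwise form of the bound of the squared
    Hellinger distance by the relative entropy. After division by [exp (L + l)] it reduces to
    [1 - l/2 <= exp (- l/2)]. *)
Lemma hellinger_le_kl L l :
  (expR ((L + l) / 2) - expR (L / 2)) ^+ 2 <=
  l * expR (L + l) + expR L - expR (L + l).
Proof.
have e2 t : expR t = expR (t / 2) ^+ 2.
  by rewrite -expRM_natr; congr expR; field.
set s := expR ((L + l) / 2); set s' := expR (L / 2).
have s0 : 0 < s by exact: expR_gt0.
have s'E : s' = s * expR (- l / 2).
  by rewrite /s -expRD; congr expR; field.
have h : 1 + (- l / 2) <= expR (- l / 2) by exact: expR_ge1Dx.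
rewrite !(e2 L) (e2 (L + l)) -/s -/s' s'E.
set t := expR _ in h *.
suff : 0 <= s ^+ 2 * (l - 2 + 2 * t) by lra.
apply: mulr_ge0; first exact: sqr_ge0.
lra.
Qed.

(** For [l < 0], square [- l <= 2 * (exp (- l/2) - 1)] and multiply by [exp (L + l)]. *)
Lemma neg_part_sq_le_hellinger L l :
  (Num.max (- l) 0) ^+ 2 * expR (L + l) <=
  4 * (expR ((L + l) / 2) - expR (L / 2)) ^+ 2.
Proof.
have e2 t : expR t = expR (t / 2) ^+ 2.
  by rewrite -expRM_natr; congr expR; field.
set s := expR ((L + l) / 2); set s' := expR (L / 2).
have s0 : 0 < s by exact: expR_gt0.
have s'E : s' = s * expR (- l / 2).
  by rewrite /s -expRD; congr expR; field.
have h : 1 + (- l / 2) <= expR (- l / 2) by exact: expR_ge1Dx.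
rewrite (e2 (L + l)) -/s s'E; set t := expR _ in h *.
have [l0|l0] := leP (- l) 0.
  by rewrite expr0n mul0r mulr_ge0// sqr_ge0.
rewrite (_ : s - s * t = s * (1 - t)); last by ring.
rewrite -subr_ge0.
rewrite (_ : _ - _ = s ^+ 2 * ((2 * (t - 1)) ^+ 2 - (- l) ^+ 2)); last by ring.
rewrite mulr_ge0 ?sqr_ge0// subr_ge0 lerXn2r ?nnegrE; lra.
Qed.

(* s^2 - s'^2 <= 2 s (s - s'), followed by AM-GM with weight t. *)
Lemma neg_part_gap_le (y s s' D t : R) : 0 <= y -> 0 <= s' <= s -> 0 < t ->
  (s - s') ^+ 2 <= D -> y * (s ^+ 2 - s' ^+ 2) <= t * (y ^+ 2 * s ^+ 2) + D / t.
Proof.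
move=> y0 /andP[s'0 ss'] t0 sD.
apply: (@le_trans _ _ (2 * (y * s) * (s - s'))).
  rewrite (_ : s ^+ 2 - s' ^+ 2 = (s - s') * (s + s')); last by ring.
  rewrite -subr_ge0 (_ : _ - _ = y * (s - s') ^+ 2); last by ring.
  by rewrite mulr_ge0// sqr_ge0.
apply: (@le_trans _ _ (t * (y ^+ 2 * s ^+ 2) + (s - s') ^+ 2 / t)); last first.
  by rewrite lerD2l ler_pM2r ?invr_gt0.
rewrite -subr_ge0.
rewrite (_ : _ - _ = (t * (y * s) - (s - s')) ^+ 2 / t); last first.
  by field; rewrite gt_eqF.
by rewrite divr_ge0 ?sqr_ge0// ltW.
Qed.

Lemma sqr_sum_le k (u : nat -> R) :
  (\sum_(i < k) u i) ^+ 2 <= k%:R * \sum_(i < k) u i ^+ 2.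
Proof.
rewrite expr2 big_distrlr /=.
apply: (@le_trans _ _ (\sum_(i < k) \sum_(j < k) (u i ^+ 2 / 2 + u j ^+ 2 / 2))).
  apply: ler_sum => i _; apply: ler_sum => j _.
  have := sqr_ge0 (u i - u j); lra.
pose V := \sum_(i < k) u i ^+ 2.
rewrite (eq_bigr (fun i : 'I_k => k%:R * (u i ^+ 2 / 2) + V / 2)); last first.
  move=> i _; rewrite big_split/= sumr_const card_ord -mulr_suml mulr_natl.
  by [].
rewrite big_split /= sumr_const card_ord -mulr_sumr -mulr_suml -/V -mulr_natl.
lra.
Qed.

(** Cauchy-Schwarz on the telescoping sum. The order of [i] and [j] is free because the minimum over
    a window may be attained before or after a given index. *)
Lemma telescope_sqr_le k (u : nat -> R) i j : (i <= k)%N -> (j <= k)%N ->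
  (u i - u j) ^+ 2 <= k%:R * \sum_(m < k) (u m.+1 - u m) ^+ 2.
Proof.
wlog ij : i j / (i <= j)%N.
  move=> H ik jk; have [ij|/ltnW ji] := leqP i j; first exact: H.
  by rewrite -sqrrN opprB; exact: H.
move=> ik jk.
rewrite -sqrrN opprB -(telescope_sumr u ij).
apply: (@le_trans _ _ ((\sum_(m < k) `|u m.+1 - u m|) ^+ 2)); last first.
  apply: le_trans (sqr_sum_le _ (fun m => `|u m.+1 - u m|)) _.
  by under eq_bigr do rewrite real_normK ?num_real//.
rewrite -real_normK ?num_real// lerXn2r ?nnegrE ?sumr_ge0//.
apply: le_trans (ler_norm_sum _ _ _) _.
rewrite -(big_mkord xpredT (fun m => `|u m.+1 - u m|)).
rewrite (@big_cat_nat _ _ _ j 0 k)//= (@big_cat_nat _ _ _ i 0 j)//=.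
rewrite addrAC lerDr addr_ge0// sumr_ge0//.
Qed.

(** Otherwise [u n > e / n] from [n0] on, and the harmonic series would have bounded partial
    sums. *)
Lemma small_terms (u : nat -> R) (S : R) : (forall n, 0 <= u n) ->
  (forall n, \sum_(i < n) u i <= S) ->
  forall (e : R) n0, 0 < e -> exists2 n, (n0 <= n)%N & n%:R * u n <= e.
Proof.
move=> u0 uS e n0 e0; apply: contrapT => H.
have Hn n : (n0 <= n)%N -> e < n%:R * u n.
  by move=> n0n; rewrite ltNge; apply/negP => ?; apply: H; exists n.
(* [harmonic n] is [1/(n+1)], so [n * u n] is first enlarged to [(n+1) * u n]. *)
have hle n : (n0 <= n)%N -> harmonic n <= u n / e.
  move=> n0n; rewrite /= ler_pdivlMr// mulrC ler_pdivrMr ?ltr0n//.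
  apply: (le_trans (ltW (Hn n n0n))).
  by rewrite mulrC ler_wpM2l// ler_nat.
apply: (@dvg_harmonic R); apply: nondecreasing_is_cvgn.
  apply/nondecreasing_seqP => n; rewrite /series/= big_nat_recr//= lerDl.
  by rewrite invr_ge0.
exists (\sum_(0 <= i < n0) harmonic i + S / e) => _ [n _ <-].
rewrite /series/=.
apply: (@le_trans _ _ (\sum_(0 <= i < n)
    ((if (i < n0)%N then harmonic i else 0) + u i / e))).
  apply: ler_sum_nat => i _; case: ltnP => in0.
    by rewrite lerDl divr_ge0// ltW.
  by rewrite add0r; exact: hle.
rewrite big_split/= lerD//.
  apply: (@le_trans _ _ (\sum_(0 <= i < n0 + n)
      (if (i < n0)%N then harmonic i else 0))).
    rewrite (@big_cat_nat _ _ _ n 0 (n0 + n))//= ?leq_addl// lerDl sumr_ge0// => i _.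
    by case: ifP => // _; rewrite invr_ge0.
  rewrite (@big_cat_nat _ _ _ n0 0 (n0 + n))//= ?leq_addr//.
  rewrite [X in _ + X <= _]big_nat_cond [X in _ + X <= _]big1 ?addr0; last first.
    by move=> i /andP[/andP[n0i _] _]; rewrite ltnNge n0i.
  by apply: ler_sum_nat => i /andP[_ ->].
by rewrite -mulr_suml ler_pM2r ?invr_gt0// big_mkord.
Qed.

End real_inequalities.

(** * Bounded measurable functions and their integrals *)

Section bounded_measurable_theory.
Context (R : realType) d (T : measurableType d).
Implicit Types (P : probability T R) (f g : T -> R).

Definition bounded_measurable f : Prop :=
  measurable_fun setT f /\ exists M, forall x, `|f x| <= M.

Lemma bounded_measurable_cst (c : R) : bounded_measurable (fun=> c).
Proof. by split; [exact: measurable_cst|exists `|c|]. Qed.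

Lemma bounded_measurableD f g : bounded_measurable f -> bounded_measurable g ->
  bounded_measurable (fun x => f x + g x).
Proof.
move=> [mf [M fM]] [mg [N gN]]; split; first exact: measurable_funD.
by exists (M + N) => x; rewrite (le_trans (ler_normD _ _))// lerD.
Qed.

Lemma bounded_measurableM f g : bounded_measurable f -> bounded_measurable g ->
  bounded_measurable (fun x => f x * g x).
Proof.
move=> [mf [M fM]] [mg [N gN]]; split; first exact: measurable_funM.
by exists (M * N) => x; rewrite normrM ler_pM.
Qed.

Lemma bounded_measurableB f g : bounded_measurable f -> bounded_measurable g ->
  bounded_measurable (fun x => f x - g x).
Proof.
move=> [mf [M fM]] [mg [N gN]]; split; first exact: measurable_funB.
by exists (M + N) => x; rewrite (le_trans (ler_normB _ _))// lerD.
Qed.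

Lemma bounded_measurable_sum n (h : 'I_n -> T -> R) :
  (forall i, bounded_measurable (h i)) ->
  bounded_measurable (fun x => \sum_(i < n) h i x).
Proof.
move=> bh; split; first by apply: measurable_sum => i; case: (bh i).
exists (\sum_(i < n) sval (cid (bh i).2)) => x.
apply: le_trans (ler_norm_sum _ _ _) _; apply: ler_sum => i _.
exact: (svalP (cid (bh i).2)).
Qed.

Lemma bounded_measurable_minr f g : bounded_measurable f -> bounded_measurable g ->
  bounded_measurable (fun x => Num.min (f x) (g x)).
Proof.
move=> [mf [M fM]] [mg [N gN]]; split; first exact: measurable_minr.
exists (M + N) => x; have M0 : 0 <= M by exact: le_trans (fM x).
have N0 : 0 <= N by exact: le_trans (gN x).
by rewrite /Num.min; case: ifP => _;
  [rewrite (le_trans (fM x))// lerDl|rewrite (le_trans (gN x))// lerDr].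
Qed.

Lemma bounded_measurable_maxr f g : bounded_measurable f -> bounded_measurable g ->
  bounded_measurable (fun x => Num.max (f x) (g x)).
Proof.
move=> [mf [M fM]] [mg [N gN]]; split; first exact: measurable_maxr.
exists (M + N) => x; have M0 : 0 <= M by exact: le_trans (fM x).
have N0 : 0 <= N by exact: le_trans (gN x).
by rewrite /Num.max; case: ifP => _;
  [rewrite (le_trans (gN x))// lerDr|rewrite (le_trans (fM x))// lerDl].
Qed.

Lemma bounded_measurable_expR f : bounded_measurable f ->
  bounded_measurable (fun x => expR (f x)).
Proof.
move=> [mf [M fM]]; split; first exact: measurableT_comp.
exists (expR M) => x; rewrite ger0_norm ?expR_ge0// ler_expR.
exact: le_trans (ler_norm _) _.
Qed.

Lemma bounded_measurable_integrable P f :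
  bounded_measurable f -> P.-integrable setT (EFin \o f).
Proof.
move=> [mf [M fM]]; apply: measurable_bounded_integrable => //.
  exact: le_lt_trans (probability_le1 P measurableT) (ltry 1).
exists M; split; first exact: num_real.
by move=> N MN x _; exact: le_trans (fM x) (ltW MN).
Qed.

Lemma integrable_bounded_measurableM P f g : P.-integrable setT (EFin \o f) ->
  bounded_measurable g -> P.-integrable setT (EFin \o (fun x => f x * g x)).
Proof.
move=> intf [mg [M gM]]; have /measurable_EFinP mf := measurable_int _ intf.
apply: (@le_integrable _ _ _ _ _ measurableT _ (fun x => (M%:E * (f x)%:E)%E)).
- by apply/measurable_EFinP; exact: measurable_funM.
- move=> x _ /=; rewrite lee_fin !normrM mulrC ler_wpM2r//.
  exact: le_trans (gM x) (ler_norm _).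
- exact: integrableZl.
Qed.

Lemma Rintegral_sum P n (h : 'I_n -> T -> R) :
  (forall i, P.-integrable setT (EFin \o h i)) ->
  \int[P]_x (\sum_(i < n) h i x) = \sum_(i < n) \int[P]_x h i x.
Proof.
move=> ih; rewrite /Rintegral.
under eq_integral do rewrite -sumEFin.
rewrite (integral_sum measurableT ih) -sum_fine// => i _.
exact: (integrable_fin_num measurableT (ih i)).
Qed.

Lemma Rintegral_probability_cst P (c : R) : \int[P]_x c = c.
Proof.
rewrite Rintegral_cst// -[RHS]mulr1; congr (_ * _).
exact: (congr1 fine (probability_setT P)).
Qed.

Lemma eq_law_Rintegral P (Q : probability T R) f (h : R -> R) :
  (forall B, measurable B -> P (f @^-1` B) = Q (f @^-1` B)) ->
  measurable_fun setT f -> measurable_fun setT h ->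
  bounded_measurable (h \o f) -> \int[P]_x h (f x) = \int[Q]_x h (f x).
Proof.
move=> PQ mf mh bhf; congr fine.
have push (P' : probability T R) :
    (\int[pushforward P' f]_y (h y)%:E = \int[P']_x (h (f x))%:E)%E.
  rewrite integral_pushforward//; first exact/measurable_EFinP.
  exact: bounded_measurable_integrable.
by rewrite -!push; apply: eq_measure_integral => B mB _; exact: PQ.
Qed.

Lemma Rintegral_density P (Q : probability T R) f q :
  is_density P Q q -> bounded_measurable f -> 
  \int[Q]_x f x = \int[P]_x (f x * q x).
Proof. by move=> qd [mf _]; rewrite /Rintegral (integral_density qd). Qed.

End bounded_measurable_theory.

(** * Relative entropy along the iteration *)

Section iterates.
Context (R : realType) d (T : measurableType d).
Variables (P0 : probability T R) (P : nat -> probability T R) (k : nat).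
Variable l : nat -> T -> R.
Hypothesis k0 : (0 < k)%N.
Hypothesis bl : forall n, bounded_measurable (l n).
Hypothesis P0E : P 0%N = P0.
Hypothesis Pstep : forall n, is_density (P n) (P n.+1) (fun x => expR (l n x)).

(* [l n] is the logarithm of the density of [P n.+1] with respect to [P n]. *)
Definition log_dens n x := \sum_(j < n) l j x.
Definition dens n x := expR (log_dens n x).

Lemma log_densS n x : log_dens n.+1 x = log_dens n x + l n x.
Proof. by rewrite /log_dens big_ord_recr. Qed.

Lemma densS n x : dens n.+1 x = dens n x * expR (l n x).
Proof. by rewrite /dens log_densS expRD. Qed.

Lemma bounded_log_dens n : bounded_measurable (log_dens n).
Proof. exact: (bounded_measurable_sum (fun i : 'I_n => bl i)). Qed.

Lemma bounded_dens n : bounded_measurable (dens n).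
Proof. exact: bounded_measurable_expR (bounded_log_dens n). Qed.

Lemma dens_is_density n : is_density P0 (P n) (dens n).
Proof.
elim: n => [|n IH]; split.
- by case: (bounded_dens 0).
- by move=> x; exact: expR_ge0.
- move=> A mA; rewrite P0E -[LHS]mul1e -integral_cst//.
  by apply: eq_integral => x _; rewrite /dens /log_dens big_ord0 expR0.
- by case: (bounded_dens n.+1).
- by move=> x; exact: expR_ge0.
- move=> A mA; case: (Pstep n) => ml _ ->//.
  rewrite integral_mkcond [RHS]integral_mkcond (ge0_integral_density IH).
  + apply: eq_integral => x _; rewrite !patchE; case: ifP => _; last by rewrite mul0e.
    by rewrite densS -EFinM mulrC.
  + by apply/(measurable_restrictT _ _).1 => //; exact/measurable_EFinP/measurable_funTS.
  + by move=> x; rewrite patchE; case: ifP => _ //; rewrite lee_fin expR_ge0.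
Qed.

Lemma Rintegral_dens n f : bounded_measurable f ->
  \int[P n]_x f x = \int[P0]_x (f x * dens n x).
Proof. exact: Rintegral_density (dens_is_density n). Qed.

Lemma Rintegral_dens1 n : \int[P0]_x dens n x = 1.
Proof.
have := Rintegral_dens n (@bounded_measurable_cst _ _ T 1).
rewrite Rintegral_probability_cst => ->.
by apply: eq_Rintegral => x _; rewrite mul1r.
Qed.

(** The relative entropy of [P n.+1] with respect to [P n], as a real number. *)
Definition kl_step n := \int[P n.+1]_x l n x.

Let int f : bounded_measurable f -> P0.-integrable setT (EFin \o f).
Proof. exact: bounded_measurable_integrable. Qed.

(** The integrand, with respect to [P0], of the squared Hellinger distance of [P n.+1] and [P n],
    without the factor 1/2. *)
Definition hellinger n x := (expR (log_dens n.+1 x / 2) - expR (log_dens n x / 2)) ^+ 2.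

Lemma bounded_hellinger n : bounded_measurable (hellinger n).
Proof.
have bh m : bounded_measurable (fun x => expR (log_dens m x / 2)).
  apply: bounded_measurable_expR.
  apply: bounded_measurableM; first exact: bounded_log_dens.
  exact: bounded_measurable_cst.
by rewrite /hellinger; under eq_fun do rewrite expr2;
  apply: bounded_measurableM; exact: bounded_measurableB.
Qed.

(** The extra terms [dens n - dens n.+1] in the pointwise bound integrate to zero, both densities
    having mass 1. *)
Lemma hellinger_le n : \int[P0]_x hellinger n x <= kl_step n.
Proof.
have blp : bounded_measurable (fun x => l n x * dens n.+1 x).
  by apply: bounded_measurableM => //; exact: bounded_dens.
have bp := bounded_dens n; have bp' := bounded_dens n.+1.
apply: (@le_trans _ _ (\int[P0]_x (l n x * dens n.+1 x + dens n x - dens n.+1 x))).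
  apply: le_Rintegral => //; first exact: int (bounded_hellinger n).
    apply: int; apply: bounded_measurableB => //; exact: bounded_measurableD.
  by move=> x _; rewrite /hellinger /dens log_densS; exact: hellinger_le_kl.
rewrite RintegralB//; [|exact: int (bounded_measurableD blp bp)|exact: int].
rewrite RintegralD//; [|exact: int|exact: int].
by rewrite !Rintegral_dens1 addrK /kl_step Rintegral_dens.
Qed.

Lemma kl_ge0 n : 0 <= kl_step n.
Proof.
by apply: le_trans (hellinger_le n); apply: Rintegral_ge0 => x _; exact: sqr_ge0.
Qed.

Definition neg_part n x := Num.max (- l n x) 0.

Lemma bounded_neg_part n : bounded_measurable (neg_part n).
Proof.
apply: bounded_measurable_maxr; last exact: bounded_measurable_cst.
under eq_fun do rewrite -mulN1r.
by apply: bounded_measurableM => //; exact: bounded_measurable_cst.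
Qed.

Lemma neg_part_le n : \int[P n.+1]_x (neg_part n x ^+ 2) <= 4 * kl_step n.
Proof.
have bn : bounded_measurable (fun x => neg_part n x ^+ 2).
  under eq_fun do rewrite expr2.
  by apply: bounded_measurableM; exact: bounded_neg_part.
rewrite Rintegral_dens//.
apply: (@le_trans _ _ (\int[P0]_x (4 * hellinger n x))).
  apply: le_Rintegral => //.
  - by apply: int; apply: bounded_measurableM => //; exact: bounded_dens.
  - apply: int; apply: bounded_measurableM; last exact: bounded_hellinger.
    exact: bounded_measurable_cst.
  - by move=> x _; rewrite /hellinger /dens log_densS; exact: neg_part_sq_le_hellinger.
rewrite RintegralZl//; last exact: int (bounded_hellinger n).
by rewrite ler_pM2l//; exact: hellinger_le.
Qed.

(* Steps j and n that agree modulo k fit the same marginal, and l j only depends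
   on the corresponding component of phi. *)
Hypothesis law : forall j n (B : set R), j = n %[mod k] -> measurable B ->
  P n.+1 (l j @^-1` B) = P j.+1 (l j @^-1` B).

(** For [m = k] this is a minimum of [k+1] densities: the last [k] carry all the fitted marginals,
    while [dens N] gives the comparison of the logarithm of the minimum with [log_dens N]. *)
Fixpoint window_min N m x :=
  if m is m'.+1 then Num.min (window_min N m' x) (dens (N + m) x) else dens N x.

Lemma window_min_le N m i x : (i <= m)%N -> window_min N m x <= dens (N + i) x.
Proof.
elim: m => [|m IH] /=; first by rewrite leqn0 => /eqP ->; rewrite addn0.
rewrite leq_eqVlt => /predU1P[->|/IH im]; rewrite ge_min ?lexx ?orbT//.
by rewrite im.
Qed.

Lemma window_min_attained N m x : exists2 i, (i <= m)%N & window_min N m x = dens (N + i) x.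
Proof.
elim: m => [|m [i im E]] /=; first by exists 0%N => //; rewrite addn0.
rewrite /Num.min; case: ifP => _; first by exists i => //; exact: leqW.
by exists m.+1.
Qed.

Lemma window_min_gt0 N m x : 0 < window_min N m x.
Proof. by have [i _ ->] := window_min_attained N m x; exact: expR_gt0. Qed.

Lemma bounded_window_min N m : bounded_measurable (window_min N m).
Proof.
by elim: m => [|m IH] /=; [|apply: bounded_measurable_minr => //]; exact: bounded_dens.
Qed.

Lemma window_min_dist_le N m (f : T -> R) x :
  `|window_min N m x - f x| <= \sum_(i < m.+1) `|dens (N + i) x - f x|.
Proof.
have [i im ->] := window_min_attained N m x; move: im; rewrite -ltnS => im.
by rewrite (bigD1 (Ordinal im))//= lerDl sumr_ge0.
Qed.

(** At each point the minimum is one of the densities of the window, so its square root differs from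
    that of [dens (N + i)] by increments whose squares are the [hellinger] terms. The free weight
    [t] is tuned later. *)
Lemma window_gap N i j (t : R) x : (i <= k)%N -> 0 < t ->
  neg_part j x * (dens (N + i) x - window_min N k x) <=
  t * (neg_part j x ^+ 2 * dens (N + i) x) +
  k%:R / t * \sum_(m < k) hellinger (N + m) x.
Proof.
move=> ik t0; have [i' ik' E] := window_min_attained N k x.
have e2 n : dens n x = expR (log_dens n x / 2) ^+ 2.
  by rewrite /dens -expRM_natr; congr expR; field.
have le' := window_min_le N x ik; rewrite {}E in le' *.
rewrite !e2.
rewrite [k%:R / t * _]mulrAC; apply: neg_part_gap_le => //.
- by rewrite le_max lexx orbT.
- rewrite expR_ge0/=; move: le'; rewrite /dens !ler_expR => le'.
  by rewrite ler_pM2r.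
- have := telescope_sqr_le (fun m => expR (log_dens (N + m) x / 2)) ik ik'.
  by rewrite /hellinger; under [X in _ <= _ * X -> _]eq_bigr do rewrite addnS.
Qed.

Lemma kl_law j n : j = n %[mod k] -> \int[P n.+1]_x l j x = kl_step j.
Proof.
move=> jn; apply: (@eq_law_Rintegral _ _ _ _ _ (l j) id) => //.
- by move=> B mB; exact: law.
- by case: (bl j).
- exact: bl j.
Qed.

Lemma neg_part_law j n : j = n %[mod k] ->
  \int[P n.+1]_x (neg_part j x ^+ 2) <= 4 * kl_step j.
Proof.
move=> jn; apply: le_trans (neg_part_le j).
rewrite (_ : Rintegral _ _ _ = \int[P j.+1]_x (neg_part j x ^+ 2))//.
apply: (@eq_law_Rintegral _ _ _ _ _ (l j) (fun y => Num.max (- y) 0 ^+ 2)) => //.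
- by move=> B mB; exact: law.
- by case: (bl j).
- by apply: measurable_funX; apply: measurable_maxr.
- rewrite (_ : _ \o _ = fun x => neg_part j x * neg_part j x); last first.
    by apply/funext => x; rewrite /neg_part/= expr2.
  by apply: bounded_measurableM; exact: bounded_neg_part.
Qed.

(** As [k] divides [N], step [N + j %% k] fits the same marginal as step [j], and the density [q] it
    produces integrates [l j] to [kl_step j]. Replacing [q] by the smaller [window_min] costs at
    most [neg_part j] times the gap. *)
Lemma window_l N j (t : R) : (N %% k = 0)%N -> 0 < t ->
  \int[P0]_x (window_min N k x * l j x) <=
  (1 + 4 * t) * kl_step j + k%:R / t * \sum_(m < k) kl_step (N + m).
Proof.
move=> Nk t0; pose i := (j %% k)%N.
have jN : j = N + i %[mod k] by rewrite -modnDml Nk add0n modn_mod.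
have ik : (i.+1 <= k)%N by rewrite ltn_pmod.
pose q x := dens (N + i.+1) x.
pose S x := \sum_(m < k) hellinger (N + m) x.
have bq : bounded_measurable q := bounded_dens _.
have bS : bounded_measurable S.
  by apply: bounded_measurable_sum => m; exact: bounded_hellinger.
have bql : bounded_measurable (fun x => l j x * q x) by exact: bounded_measurableM.
have bn2q : bounded_measurable (fun x => neg_part j x ^+ 2 * q x).
  apply: bounded_measurableM => //; under eq_fun do rewrite expr2.
  by apply: bounded_measurableM; exact: bounded_neg_part.
have btn : bounded_measurable (fun x => t * (neg_part j x ^+ 2 * q x)).
  by apply: bounded_measurableM => //; exact: bounded_measurable_cst.
have bkS : bounded_measurable (fun x => k%:R / t * S x).
  by apply: bounded_measurableM => //; exact: bounded_measurable_cst.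
apply: (@le_trans _ _ (\int[P0]_x (l j x * q x +
    (t * (neg_part j x ^+ 2 * q x) + k%:R / t * S x)))).
  apply: le_Rintegral => //.
  - by apply: int; apply: bounded_measurableM => //; exact: bounded_window_min.
  - by apply: int; do 2 apply: bounded_measurableD => //.
  - move=> x _; rewrite -lerBlDl; apply: le_trans (window_gap N j x ik t0).
    rewrite -/(q x) (_ : _ - _ = - l j x * (q x - window_min N k x)); last by ring.
    by rewrite ler_wpM2r ?subr_ge0 ?window_min_le// /neg_part le_max lexx.
rewrite RintegralD//; [|exact: int|by apply: int; exact: bounded_measurableD].
rewrite RintegralD//; [|exact: int|exact: int].
rewrite RintegralZl//; last exact: int.
rewrite RintegralZl//; last exact: int.
have -> : \int[P0]_x S x = \sum_(m < k) \int[P0]_x hellinger (N + m) x.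
  by apply: Rintegral_sum => m; apply: int; exact: bounded_hellinger.
have -> : \int[P0]_x (l j x * q x) = kl_step j.
  by rewrite -Rintegral_dens// addnS kl_law.
have h1 : \int[P0]_x (neg_part j x ^+ 2 * q x) <= 4 * kl_step j.
  rewrite -Rintegral_dens; last first.
    by under eq_fun do rewrite expr2; apply: bounded_measurableM; exact: bounded_neg_part.
  by rewrite addnS neg_part_law.
have h2 : \sum_(m < k) \int[P0]_x hellinger (N + m) x <= \sum_(m < k) kl_step (N + m).
  by apply: ler_sum => m _; exact: hellinger_le.
rewrite mulrDl mul1r -addrA lerD2l lerD//.
  by rewrite -mulrA mulrCA ler_pM2l.
by rewrite ler_wpM2l// divr_ge0// ltW.
Qed.

(** Summing over [j < N] repeats the window error [N] times, so a window whose entropy is small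
    compared with [1/N] will be required. *)
Lemma window_logd N (t : R) : (N %% k = 0)%N -> 0 < t ->
  \int[P0]_x (window_min N k x * log_dens N x) <=
  (1 + 4 * t) * (\sum_(j < N) kl_step j) +
  N%:R * (k%:R / t * \sum_(m < k) kl_step (N + m)).
Proof.
move=> Nk t0; under eq_Rintegral do rewrite /log_dens mulr_sumr.
rewrite Rintegral_sum; last first.
  by move=> j; apply: int; apply: bounded_measurableM => //; exact: bounded_window_min.
apply: (@le_trans _ _ (\sum_(j < N)
    ((1 + 4 * t) * kl_step j + k%:R / t * \sum_(m < k) kl_step (N + m)))).
  by apply: ler_sum => j _; exact: window_l.
by rewrite big_split/= -mulr_sumr sumr_const card_ord -[X in _ + X <= _]mulr_natl.
Qed.

Let icst (c : R) : P0.-integrable setT (EFin \o (fun=> c)).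
Proof. by apply: int; exact: bounded_measurable_cst. Qed.

Lemma block_sum n : \sum_(t < n) \sum_(m < k) kl_step (t * k + m) =
  \sum_(j < n * k) kl_step j.
Proof.
elim: n => [|n IH]; first by rewrite mul0n !big_ord0.
rewrite big_ord_recr/= {}IH mulSn addnC big_split_ord/=; congr (_ + _).
Qed.

(** As [q] has mass 1, the right side is the relative entropy of [Q], written with a nonnegative
    integrand. [Q] integrates [log_dens N] to the sum on the left; the Gibbs inequality with
    [u = log_dens N] concludes, since [1 - dens N] has integral 0. *)
Lemma kl_sum_le (Q : probability T R) (q : T -> R) N :
  is_density P0 Q q ->
  (forall j (B : set R), measurable B -> Q (l j @^-1` B) = P j.+1 (l j @^-1` B)) ->
  P0.-integrable setT (EFin \o (fun x => q x * ln (q x) - q x + 1)) ->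
  \sum_(j < N) kl_step j <= \int[P0]_x (q x * ln (q x) - q x + 1).
Proof.
move=> qd Qlaw iPhi; have iq := density_integrable qd.
have -> : \sum_(j < N) kl_step j = \int[P0]_x (q x * log_dens N x).
  transitivity (\int[Q]_x log_dens N x).
    rewrite Rintegral_sum; last first.
      by move=> j; exact: bounded_measurable_integrable.
    apply: eq_bigr => j _.
    apply: (@eq_law_Rintegral _ _ _ _ _ (l j) id) => //.
    - by move=> B mB; rewrite Qlaw.
    - by case: (bl j).
    - exact: bl j.
  rewrite (Rintegral_density qd); last exact: bounded_log_dens.
  by apply: eq_Rintegral => x _; rewrite mulrC.
have iql := integrable_bounded_measurableM iq (bounded_log_dens N).
have i1 : P0.-integrable setT (EFin \o (fun x => 1 - dens N x)).
  apply: int; apply: bounded_measurableB; last exact: bounded_dens.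
  exact: bounded_measurable_cst.
apply: (@le_trans _ _ (\int[P0]_x (q x * log_dens N x + (1 - dens N x)))).
  rewrite RintegralD// RintegralB//; last exact: int (bounded_dens N).
    by rewrite Rintegral_dens1 Rintegral_probability_cst subrr addr0.
apply: le_Rintegral => //.
  exact: (integrableD measurableT iql i1).
move=> x _; rewrite addrA; apply: gibbs_ineq; case: qd => _ + _; exact.
Qed.

(** The dual form of the entropy bound, with a bounded test function [h], survives replacing [finf]
    by the window minimum at a cost controlled by their L^1 distance; Gibbs and [window_logd] then
    apply to the minimum. *)
Lemma truncated_le (finf : T -> R) (I : R) (h : T -> R)
    (Pinf : probability T R) :
  is_density P0 Pinf finf ->
  (forall e, 0 < e -> exists n0, forall n, (n0 <= n)%N ->
     \int[P0]_x `|dens n x - finf x| <= e) ->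
  (forall N, \sum_(j < N) kl_step j <= I) ->
  bounded_measurable h ->
  \int[P0]_x (finf x * h x + 1 - expR (h x)) <= I.
Proof.
move=> fd cvg SI bh; have I0 : 0 <= I by have := SI 0%N; rewrite big_ord0.
have ifinf := density_integrable fd.
have [mh [B hB]] := bh.
have B0 : 0 <= B by exact: le_trans (hB point).
(* The errors below add up to [th * (4 * I + B + 2)]: [4 * th * I] and [th] from [window_logd],
   [(B + 1) * th] from the L^1 distance. One more unit is slack. *)
pose K := 4 * I + B + 3; have K0 : 0 < K by rewrite /K; lra.
have kR0 : 0 < k%:R :> R by rewrite ltr0n.
apply/ler_addgt0Pr => e e0; pose th := e / K.
have th0 : 0 < th by rewrite divr_gt0.
have [n0 Hn0] := cvg (th / k.+1%:R) (divr_gt0 th0 (ltr0Sn _ _)).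
(* Entropies are grouped in blocks of length [k]. The bound [th^2 / k^2] on [t] times the block sum
   is what makes the window error at [N = t * k] at most [th]. *)
have [t n0t tu] := @small_terms R (fun t => \sum_(m < k) kl_step (t * k + m)) I
  (fun n => sumr_ge0 _ (fun i _ => kl_ge0 _))
  (fun n => eq_ind_r (fun z => z <= I) (SI _) (block_sum n))
  (th ^+ 2 / k%:R ^+ 2) n0 (divr_gt0 (exprn_gt0 _ th0) (exprn_gt0 _ kR0)).
pose N := (t * k)%N.
have n0N : (n0 <= N)%N by apply: leq_trans n0t _; rewrite leq_pmulr.
have Nk : (N %% k = 0)%N by rewrite modnMl.
have idist n : P0.-integrable setT (EFin \o (fun x => `|dens n x - finf x|)).
  apply: integrable_norm; exact: (integrableB measurableT (int (bounded_dens n)) ifinf).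
have idw : P0.-integrable setT (EFin \o (fun x => `|window_min N k x - finf x|)).
  apply: integrable_norm; exact: (integrableB measurableT (int (bounded_window_min N k)) ifinf).
have dist_le : \int[P0]_x `|window_min N k x - finf x| <= th.
  apply: (@le_trans _ _ (\int[P0]_x (\sum_(i < k.+1) `|dens (N + i) x - finf x|))).
    apply: le_Rintegral => //; last by move=> x _; exact: window_min_dist_le.
    have := integrable_sum measurableT (index_enum 'I_k.+1)
      (fun (i : 'I_k.+1) (_ : xpredT i) => idist (N + i)%N).
    by apply: eq_integrable => // x _ /=; rewrite sumEFin.
  rewrite Rintegral_sum//.
  apply: (@le_trans _ _ (\sum_(i < k.+1) (th / k.+1%:R))).
    by apply: ler_sum => i _; apply: Hn0; rewrite (leq_trans n0N)// leq_addr.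
  by rewrite sumr_const card_ord -[leLHS]mulr_natr divfK ?pnatr_eq0.
have iwl : P0.-integrable setT (EFin \o (fun x => window_min N k x * log_dens N x)).
  by apply: int; apply: bounded_measurableM; [exact: bounded_window_min|exact: bounded_log_dens].
have i1f : P0.-integrable setT (EFin \o (fun x => 1 - finf x)).
  exact: (integrableB measurableT (icst 1) ifinf).
have iB : P0.-integrable setT (EFin \o (fun x => (B + 1) * `|window_min N k x - finf x|)).
  exact: (integrableZl measurableT (B + 1) idw).
apply: (@le_trans _ _ (\int[P0]_x (window_min N k x * log_dens N x + ((1 - finf x) +
    (B + 1) * `|window_min N k x - finf x|)))).
  apply: le_Rintegral => //.
  - have ifh := integrable_bounded_measurableM ifinf bh.
    exact: (integrableB measurableT (integrableD measurableT ifh (icst 1))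
      (int (bounded_measurable_expR bh))).
  - exact: (integrableD measurableT iwl (integrableD measurableT i1f iB)).
  - move=> x _; set w := window_min N k x.
    have w0 : 0 < w := window_min_gt0 N k x.
    have g := gibbs_ineq (h x) (ltW w0).
    have wl : w * ln w <= w * log_dens N x.
      rewrite ler_pM2l// -(expRK (log_dens N x)) ler_ln ?posrE ?expR_gt0//.
      by have := window_min_le N x (leq0n k); rewrite addn0.
    have d1 : (finf x - w) * h x <= B * `|w - finf x|.
      rewrite -normrN opprB; apply: (le_trans (ler_norm _)).
      by rewrite normrM mulrC ler_wpM2r.
    have d2 := ler_norm (finf x - w); rewrite distrC in d2.
    nra.
rewrite RintegralD//; last exact: (integrableD measurableT i1f iB).
rewrite RintegralD// RintegralZl// RintegralB//.
have -> : \int[P0]_x finf x = 1.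
  have := Rintegral_density fd (@bounded_measurable_cst _ _ T 1).
  rewrite Rintegral_probability_cst => ->.
  by apply: eq_Rintegral => x _; rewrite mul1r.
rewrite Rintegral_probability_cst subrr add0r.
have W := window_logd Nk th0.
have W2 : N%:R * (k%:R / th * \sum_(m < k) kl_step (N + m)) <= th.
  rewrite natrM (_ : _ * _ =
    (k%:R ^+ 2 / th) * (t%:R * \sum_(m < k) kl_step (N + m))); last by ring.
  apply: (@le_trans _ _ (k%:R ^+ 2 / th * (th ^+ 2 / k%:R ^+ 2))).
    by rewrite ler_pM2l// divr_gt0// exprn_gt0.
  rewrite le_eqVlt; apply/orP; left; apply/eqP; field.
  by rewrite !gt_eqF.
have W3 : (1 + 4 * th) * \sum_(j < N) kl_step j <= (1 + 4 * th) * I.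
  by rewrite ler_pM2l; [exact: SI|lra].
have W4 : (B + 1) * \int[P0]_x `|window_min N k x - finf x| <= (B + 1) * th.
  by rewrite ler_pM2l//; lra.
have eE : e = th * K by rewrite divfK// gt_eqF.
rewrite eE /K; nra.
Qed.

End iterates.

(** * Passage to the limit *)

(** The sets where [p >= q] and where [p < q] each contribute at most [e]. *)
Lemma Rintegral_dist_le_tv (R : realType) d (T : measurableType d)
    (P0 P Q : probability T R) (p q : T -> R) (e : R) :
  is_density P0 P p -> is_density P0 Q q ->
  (forall A, measurable A -> (`|P A - Q A| <= e%:E)%E) ->
  \int[P0]_x `|p x - q x| <= 2 * e.
Proof.
move=> pd qd PQ.
have ip := density_integrable pd; have iq := density_integrable qd.
have [mp p0 pE] := pd; have [mq q0 qE] := qd.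
pose E := [set x | 0 <= p x - q x].
have mE : measurable E.
  rewrite (_ : E = (fun x => p x - q x) @^-1` `[0, +oo[); last first.
    by apply/seteqP; split=> x /=; rewrite in_itv /= andbT.
  by rewrite -[X in measurable X]setTI; exact: measurable_funB.
have mEC := measurableC mE.
have iS (A : set T) (f : T -> R) : measurable A ->
    P0.-integrable setT (EFin \o f) -> P0.-integrable A (EFin \o f).
  by move=> mA; apply: integrableS.
have ipq : P0.-integrable setT (EFin \o (fun x => `|p x - q x|)).
  by apply: integrable_norm; exact: (integrableB measurableT ip iq).
have diff A : measurable A -> `|\int[P0]_(x in A) p x - \int[P0]_(x in A) q x| <= e.
  move=> mA; have := PQ A mA; rewrite pE// qE//.
  have fp := integrable_fin_num mA (iS A p mA ip).
  have fq := integrable_fin_num mA (iS A q mA iq).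
  by rewrite -(fineK fp) -(fineK fq) -EFinB lee_fin.
rewrite -(setUCr E) Rintegral_setU//; last 2 first.
- by rewrite setUCr.
- by apply/disj_set2P; rewrite setICr.
rewrite (_ : \int[P0]_(x in E) _ = \int[P0]_(x in E) (p x - q x)); last first.
  by apply: eq_Rintegral => x /set_mem xE; rewrite ger0_norm.
rewrite (_ : \int[P0]_(x in ~` E) _ = \int[P0]_(x in ~` E) (q x - p x)); last first.
  apply: eq_Rintegral => x /set_mem /negP; rewrite -ltNge => xE.
  by rewrite ltr0_norm// opprB.
rewrite !RintegralB//; [|exact: iS..].
have := diff _ mE; have := diff _ mEC; rewrite (distrC (Rintegral _ _ p)).
move=> /(le_trans (ler_norm _)) h1 /(le_trans (ler_norm _)) h2; lra.
Qed.

Lemma tv_cvgP (R : realType) d (T : measurableType d)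
    (P : nat -> probability T R) (Q : probability T R) : tv_cvg P Q ->
  forall e : R, 0 < e -> exists n0, forall n, (n0 <= n)%N ->
    forall A, measurable A -> (`|P n A - Q A| <= e%:E)%E.
Proof.
move=> PQ e e0.
have : (\forall n \near \oo, tv_dist (P n) Q < e%:E)%E.
  by apply: (PQ [set y | (y < e%:E)%E]); apply: open_ereal_lt'; rewrite lte_fin.
move=> [n0 _ H]; exists n0 => n n0n A mA.
apply: le_trans (ltW (H n n0n)); apply: ereal_sup_ubound.
by exists A.
Qed.

(** Agreement for infinitely many [n] suffices, which suits marginals fitted once per cycle. *)
Lemma tv_cvg_unique (R : realType) d (T : measurableType d)
    (P : nat -> probability T R) (Q : probability T R) (A : set T) (c : \bar R) :
  tv_cvg P Q -> measurable A -> 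
  (forall n0, exists2 n, (n0 <= n)%N & P n A = c) -> Q A = c.
Proof.
move=> PQ mA Pc.
have [n _ cE] := Pc 0%N; rewrite -{}cE in Pc *.
have fQ : Q A \is a fin_num by exact: fin_num_measure.
have fP : P n A \is a fin_num by exact: fin_num_measure.
rewrite -(fineK fQ) -(fineK fP); congr EFin; apply/eqP; rewrite eq_sym -subr_eq0.
rewrite -normr_le0; apply/ler_addgt0Pr => e e0; rewrite add0r.
have [n0 H] := tv_cvgP PQ e0; have [m n0m PmE] := Pc n0.
have := H m n0m A mA; rewrite PmE.
by case: (P n A) fP => [p| |]//= _; case: (Q A) fQ => [q| |]//= _; rewrite lee_fin.
Qed.

(** The negative part of [g + w] is dominated by that of [w]. Its positive part has infinite
    integral, for otherwise [g = (g + w) - w] would be integrable. *)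
Lemma integral_ge0D_nonintegrable (R : realType) d (T : measurableType d)
    (mu : {measure set T -> \bar R}) (g w : T -> R) :
  measurable_fun setT g -> (forall x, 0 <= g x) ->
  ~ mu.-integrable setT (EFin \o g) -> mu.-integrable setT (EFin \o w) ->
  (\int[mu]_x (g x + w x)%:E = +oo)%E.
Proof.
move=> mg g0 ng iw; have /measurable_EFinP mw := measurable_int _ iw.
pose s x := g x + w x.
have ms : measurable_fun setT (EFin \o s).
  by apply/measurable_EFinP; exact: measurable_funD.
rewrite -[LHS]/(\int[mu]_x (EFin \o s) x)%E.
have neg : (\int[mu]_x (EFin \o s)^\- x < +oo)%E.
  apply: le_lt_trans (integral_funeneg_lt_pinfty measurableT iw).
  apply: ge0_le_integral => //.
  - exact: measurable_funeneg.
  - by apply: measurable_funeneg; exact/measurable_EFinP.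
  - move=> x _; rewrite !funenegE -!EFinN -!EFin_max lee_fin.
    rewrite ge_max !le_max lexx !orbT andbT lerN2 lerDr g0//.
have [poslt|] := ltP (\int[mu]_x (EFin \o s)^\+ x)%E +oo%E.
  exfalso; apply: ng.
  have igw : mu.-integrable setT (EFin \o s).
    apply/integrableP; split=> //.
    rewrite -[X in (X < _)%E]/(\int[mu]_x (abse \o (EFin \o s)) x)%E fune_abse.
    rewrite ge0_integralD//; first by rewrite lte_add_pinfty.
    - exact: measurable_funepos.
    - exact: measurable_funeneg.
  apply: eq_integrable (integrableB measurableT igw iw) => //.
  by move=> x _ /=; rewrite -EFinB addrK.
rewrite leye_eq => /eqP posy; rewrite integralE posy.
by rewrite addye// eqe_oppLR/= lt_eqF.
Qed.

(** * Removing the truncation of the logarithm by Fatou's lemma *)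

Section fatou_limit.
Context (R : realType) d (T : measurableType d) (P0 : probability T R).
Variable f : T -> R.
Hypotheses (mf : measurable_fun setT f) (f0 : forall x, 0 <= f x).

Implicit Types y : R.

Definition clip (m : nat) (y : R) : R := Num.min m.+1%:R (Num.max m.+1%:R^-1 y).

Lemma clip_ge m y : m.+1%:R^-1 <= clip m y.
Proof.
rewrite le_min le_max lexx andbT (@le_trans _ _ 1)//.
  by rewrite invf_le1// ler1n.
by rewrite ler1n.
Qed.

Lemma clip_gt0 m y : 0 < clip m y.
Proof. by apply: lt_le_trans (clip_ge m y); rewrite invr_gt0. Qed.

Lemma clip_cases m y :
  [\/ clip m y = y, clip m y = m.+1%:R^-1 /\ y <= m.+1%:R^-1 |
      clip m y = m.+1%:R /\ m.+1%:R <= y].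
Proof.
have m1 : (m.+1%:R^-1 : R) <= 1 by rewrite invf_le1// ler1n.
have m2 : 1 <= (m.+1%:R : R) by rewrite ler1n.
rewrite /clip; have [h|h] := leP y m.+1%:R^-1.
  by apply: Or32; split=> //; apply/min_idPr; exact: le_trans m2.
have [h'|h'] := leP y m.+1%:R; first exact: Or31.
by apply: Or33; split=> //; exact: ltW.
Qed.

Lemma clip_cvg y : 0 <= y -> clip m y @[m --> \oo] --> y.
Proof.
move=> y0; apply: (@squeeze_cvgr _ _ _ _ (fun=> y) (fun m => y + harmonic m)).
- near=> m; have ym : y <= m.+1%:R.
    apply: (@le_trans _ _ m%:R); last by rewrite ler_nat.
    by near: m; exact: nbhs_infty_ger.
  have i0 : 0 <= (m.+1%:R^-1 : R) by rewrite invr_ge0.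
  have [->|[-> h]|[-> h]] := clip_cases m y => /=.
  + by rewrite lexx lerDl.
  + by rewrite h lerDr.
  + by rewrite ym (le_trans h)// lerDl.
- exact: cvg_cst.
- rewrite -[X in _ --> X]addr0; apply: cvgD; first exact: cvg_cst.
  exact: cvg_harmonic.
Unshelve. all: by end_near. Qed.

Lemma bounded_ln_clip m : bounded_measurable (fun x => ln (clip m (f x))).
Proof.
split.
  apply: measurableT_comp => //; apply: measurable_minr => //.
  exact: measurable_maxr.
exists (ln m.+1%:R) => x; rewrite ler_norml -lnV ?posrE//.
rewrite !ler_ln ?posrE ?invr_gt0 ?clip_gt0//.
by rewrite clip_ge/= ge_min lexx.
Qed.

(** Clipping moves [y] towards 1, so [(y - c) * ln c >= 0], which reduces the claim to
    [c * ln c + 1 - c >= 0]. *)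
Lemma clip_gibbs_ge0 m y : 0 <= y -> 0 <= y * ln (clip m y) + 1 - clip m y.
Proof.
move=> y0; set c := clip m y; have c0 : 0 < c := clip_gt0 m y.
have := gibbs_ineq 0 (ltW c0); rewrite mulr0 add0r expR0 subrr => g.
suff : c * ln c <= y * ln c by lra.
rewrite -subr_ge0 -mulrBl.
have m1 : (m.+1%:R^-1 : R) <= 1 by rewrite invf_le1// ler1n.
have m2 : 1 <= (m.+1%:R : R) by rewrite ler1n.
have [cE|[cE h]|[cE h]] := clip_cases m y; rewrite -/c in cE.
- by rewrite cE subrr mul0r.
- by rewrite -cE in m1 h; rewrite mulr_le0 ?subr_le0// ln_le0.
- by rewrite -cE in m2 h; rewrite mulr_ge0 ?subr_ge0// ln_ge0.
Qed.

Lemma clip_phi_cvg y : 0 <= y ->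
  y * ln (clip m y) + 1 - clip m y @[m --> \oo] --> y * ln y - y + 1.
Proof.
move=> y0; rewrite -addrA [- y + 1]addrC addrA; apply: cvgB; last exact: clip_cvg.
apply: cvgD; last exact: cvg_cst; move: y0.
rewrite le_eqVlt => /predU1P[<-|y0].
  (* At 0 the logarithm of the clipped value diverges, but its factor is identically 0. *)
  by rewrite mul0r; under eq_fun do rewrite mul0r; exact: cvg_cst.
apply: cvgM; first exact: cvg_cst.
apply: (continuous_cvg _ (continuous_ln y0)); exact: clip_cvg (ltW y0).
Qed.

(* The truncations h = ln (clip m f) make the hypothesis a bound on integrands that
   are nonnegative and tend to f ln f - f + 1, so that Fatou's lemma applies. *)
Lemma integral_phi_le (I : R) :
  P0.-integrable setT (EFin \o f) ->
  (forall h, bounded_measurable h ->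
     \int[P0]_x (f x * h x + 1 - expR (h x)) <= I) ->
  (\int[P0]_x (f x * ln (f x) - f x + 1)%:E <= I%:E)%E.
Proof.
move=> intf HI.
pose g m x := f x * ln (clip m (f x)) + 1 - clip m (f x).
have mg m : measurable_fun setT (EFin \o g m).
  apply/measurable_EFinP; have [mlc _] := bounded_ln_clip m.
  apply: measurable_funB.
    by apply: measurable_funD => //; exact: measurable_funM.
  by apply: measurable_minr => //; exact: measurable_maxr.
have g0 m x : [set: T] x -> (0 <= (EFin \o g m) x)%E.
  by move=> _; rewrite lee_fin clip_gibbs_ge0.
have := fatou P0 measurableT mg g0.
rewrite (eq_integral (fun x => (f x * ln (f x) - f x + 1)%:E)); last first.
  move=> x _; have fx : (EFin \o g m) x @[m --> \oo] --> (f x * ln (f x) - f x + 1)%:E.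
    by apply: cvg_EFin; [exact: nearW|exact: clip_phi_cvg].
  by rewrite is_cvg_limn_einfE; [exact: cvg_lim fx|apply/cvg_ex; eexists; exact: fx].
move=> /le_trans; apply.
rewrite limn_einf_lim; apply: lime_le.
  exact: is_cvg_einfs.
apply: nearW => n; apply: le_trans (ereal_inf_lbound _) _.
  by exists n => /=.
have bl := bounded_ln_clip n.
have ig : P0.-integrable setT (EFin \o (fun x =>
    f x * ln (clip n (f x)) + 1 - expR (ln (clip n (f x))))).
  have icst : P0.-integrable setT (EFin \o (fun=> (1 : R))).
    by apply: bounded_measurable_integrable; exact: bounded_measurable_cst.
  exact: (integrableB measurableT (integrableD measurableT
    (integrable_bounded_measurableM intf bl) icst)
    (bounded_measurable_integrable _ (bounded_measurable_expR bl))).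
have gE : (\int[P0]_x (EFin \o g n) x = \int[P0]_x
    (f x * ln (clip n (f x)) + 1 - expR (ln (clip n (f x))))%:E)%E.
  by apply: eq_integral => x _; rewrite /= /g lnK ?posrE ?clip_gt0.
rewrite gE -(fineK (integrable_fin_num measurableT ig)) lee_fin.
exact: HI.
Qed.

End fatou_limit.

(** * Feasibility of the limit and minimality of its relative entropy *)

Section limit.
Context (R : realType) d (T : measurableType d) (k : nat).
Context (d' : 'I_k -> measure_display) (U : forall i, measurableType (d' i)).
Context (phi : forall i, {mfun T >-> U i}) (Pobs : forall i, probability (U i) R).
Variables (P0 : probability T R) (P : nat -> probability T R).
Variable Pinf : probability T R.
Hypotheses (k0 : (0 < k)%N) (mpt : forall i (w : U i), measurable [set w]).
Hypothesis bdd : bounded_ratios phi Pobs P0.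
Hypothesis DCI : DCI_sequence phi Pobs P0 P.
Hypothesis PPinf : tv_cvg P Pinf.

(** The density of [P n.+1] with respect to [P n] is a function of the fitted component, namely the
    ratio of [Pobs i] to the current marginal; pushing forward turns that marginal into [Pobs i]. *)
Lemma DCI_marginal n (i : 'I_k) (B : set (U i)) : n = i %[mod k] ->
  measurable B -> distribution (P n.+1) (phi i) B = Pobs i B.
Proof.
move=> ni mB; have [r Hr] := DCI_ratios k0 mpt bdd DCI.
have E : i = step_index k0 n by apply/val_inj; rewrite /= ni modn_small.
move: B mB; rewrite {}E => B mB; have [K _ [mr _ rQ rP]] := Hr n.
have [_ r0 ->//] := rQ; have [_ _ rE] := rP.
have mphiB : measurable (phi (step_index k0 n) @^-1` B).
  by rewrite -[X in measurable X]setTI; exact: (measurable_funP (phi _)).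
rewrite /distribution /pushforward rE//.
rewrite ge0_integral_pushforward//.
- exact/measurable_EFinP/measurable_funTS.
- by move=> w _; rewrite lee_fin.
Qed.

Lemma DCI_limit_feasible : feasible phi Pobs P0 Pinf.
Proof.
move=> i _; split.
  apply/null_content_dominatesP => A mA P0A.
  apply: (tv_cvg_unique PPinf mA) => n; exists n => //.
  have [L L0 cmp] := DCI_comparable k0 mpt bdd DCI n.
  have [_] := cmp A mA; rewrite P0A mule0 => ?.
  by apply/eqP; rewrite eq_le measure_ge0 andbT.
move=> B mB; apply: (tv_cvg_unique PPinf).
  by rewrite -[X in measurable X]setTI; exact: (measurable_funP (phi _)).
(* Step [n0 * k + i] fits the [i]-th marginal, and its result is the iterate with the next index. *)
move=> n0; exists (n0 * k + i).+1.
  by rewrite ltnW// ltnS (leq_trans (leq_pmulr _ k0))// leq_addr.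
by apply: (DCI_marginal _ mB); rewrite modnMDl.
Qed.

(** The relative entropy of [Q] bounds every partial sum of [kl_step], and any such bound also
    bounds the relative entropy of [Pinf]. *)
Lemma DCI_limit_projection (Q : probability T R) (q finf : T -> R) :
  feasible phi Pobs P0 Q -> is_density P0 Q q -> is_density P0 Pinf finf ->
  P0.-integrable setT (EFin \o (fun x => q x * ln (q x) - q x + 1)) ->
  (\int[P0]_x (finf x * ln (finf x) - finf x + 1)%:E <=
   \int[P0]_x (q x * ln (q x) - q x + 1)%:E)%E.
Proof.
move=> fQ qd fd iq; have [r Hr] := DCI_ratios k0 mpt bdd DCI.
pose l n x := ln (r n (phi (step_index k0 n) x)).
have rpos n w : 0 < r n w.
  have [K K0 [_ rK _ _]] := Hr n; have /andP[+ _] := rK w.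
  by apply: lt_le_trans; rewrite invr_gt0.
have bl n : bounded_measurable (l n).
  have [K K0 [mr rK _ _]] := Hr n; split.
    by apply: measurableT_comp => //; exact: measurableT_comp.
  exists (ln K) => x; rewrite ler_norml -lnV ?posrE//.
  by rewrite !ler_ln ?posrE ?invr_gt0// rK.
have Pstep n : is_density (P n) (P n.+1) (fun x => expR (l n x)).
  have [K K0 [_ _ _]] := Hr n; rewrite (_ : (fun x => expR (l n x)) = r n \o phi _)//.
  by apply/funext => x; rewrite /l lnK ?posrE.
have mlr n (B : set R) : measurable B ->
    measurable ((fun w => ln (r n w)) @^-1` B).
  move=> mB; rewrite -[X in measurable X]setTI.
  suff /(_ measurableT B mB) : measurable_fun setT (fun w => ln (r n w)) by [].
  by have [K K0 [mr _ _ _]] := Hr n; exact: measurableT_comp.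
have lawobs n j (B : set R) : n = j %[mod k] -> measurable B ->
    P n.+1 (l j @^-1` B) = Pobs (step_index k0 j) ((fun w => ln (r j w)) @^-1` B).
  move=> nj mB; rewrite -(@DCI_marginal n)//; last exact: mlr.
  by rewrite nj /= modn_mod.
have law j n (B : set R) : j = n %[mod k] -> measurable B ->
    P n.+1 (l j @^-1` B) = P j.+1 (l j @^-1` B).
  by move=> jn mB; rewrite !lawobs.
have P0E : P 0%N = P0 := DCI.1.
have S N : \sum_(j < N) kl_step P l j <= \int[P0]_x (q x * ln (q x) - q x + 1).
  apply: (kl_sum_le bl P0E Pstep N qd) => // j B mB; rewrite lawobs//.
  have [_ <-//] := fQ (step_index k0 j) I.
  exact: mlr.
have ifinf := density_integrable fd; have [mf f0 _] := fd.
rewrite -(fineK (integrable_fin_num measurableT iq)).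
apply: integral_phi_le => // h bh.
apply: (truncated_le k0 bl P0E Pstep law fd) => // e e0.
have [n0 H] := tv_cvgP PPinf (divr_gt0 e0 (ltr0n _ 2)).
exists n0 => n n0n; rewrite (_ : e = 2 * (e / 2)); last by field.
exact: Rintegral_dist_le_tv (dens_is_density bl P0E Pstep n) fd (H n n0n).
Qed.

End limit.

(** The ball about [x] of radius [dist x w] avoids [w], so the complement of the point is open. This
    makes the fibres of [phi] measurable. *)
Lemma singleton_measurable (R : realType) (X : topologicalType) (x0 : X)
    (w : borel x0) :
  separable_complete_metric R X -> measurable [set w].
Proof.
move=> [_ [dist [dist0 dC dtri dnbhs _]]].
rewrite -[X in measurable X]setCK; apply: measurableC.
apply: sub_sigma_algebra; rewrite /= openE => x xw.
apply/dnbhs; exists (dist x w) => [|y /= + yw]; last by rewrite yw ltxx.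
by rewrite lt0r (dist0 x w).1 andbT; apply/eqP => /(dist0 x w).2.
Qed.

(** * From relative entropy to differential entropy *)

Section entropy.
Context (R : realType) d (T : measurableType d).
Variables (lam : {sigma_finite_measure set T -> \bar R}) (P0 : probability T R).
Variable V : R.
Hypotheses (V0 : 0 < V)
  (P0lam : forall A, measurable A -> P0 A = (lam A * V^-1%:E)%E).

Let P0d : is_density lam P0 (fun=> V^-1).
Proof.
split=> // [x|A mA]; first by rewrite invr_ge0 ltW.
by rewrite integral_cst// P0lam// muleC.
Qed.

Lemma uniform_density (Q : probability T R) g :
  is_density lam Q g -> is_density P0 Q (fun x => V * g x).
Proof.
move=> [mg g0 gE]; split.
- exact: measurable_funM.
- by move=> x; rewrite mulr_ge0// ltW.
- move=> A mA; rewrite gE// integral_mkcond [RHS]integral_mkcond.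
  rewrite (ge0_integral_density P0d).
  + apply: eq_integral => x _; rewrite !patchE; case: ifP => _; last by rewrite mul0e.
    by rewrite -EFinM mulrC mulKf// gt_eqF.
  + apply/(measurable_restrictT _ _).1 => //; apply/measurable_EFinP/measurable_funTS.
    exact: measurable_funM.
  + by move=> x; rewrite patchE; case: ifP => _ //; rewrite lee_fin mulr_ge0// ltW.
Qed.

(** With [f = V * g], where [g] is the density for [lam], one has [ln g = ln f - ln V]. The
    integrand is split into a nonnegative relative entropy term and an integrable remainder whose
    integral, [- ln V], does not depend on [Q]. *)
Lemma entropy_density (Q : probability T R) :
  Q `<< P0 -> exists f, is_density P0 Q f /\
  entropy lam Q = (- \int[P0]_x ((f x * ln (f x) - f x + 1) +
    ((1 - ln V) * f x - 1))%:E)%E.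
Proof.
move=> QP0; have Qlam : Q `<< lam.
  apply: null_dominates_trans QP0 _.
  apply/null_content_dominatesP => A mA lA0.
  by rewrite P0lam// lA0 mul0e.
have [gd RNg] := RN_density Qlam.
set g := fun x => `|RN Q lam x| in gd RNg.
exists (fun x => V * g x); split; first exact: uniform_density.
have [mg g0 _] := gd.
have mf : measurable_fun setT (fun x => V * g x) by exact: measurable_funM.
congr (- _)%E; rewrite (integral_density P0d); last first.
  apply: measurable_funD; last by apply: measurable_funB => //; exact: measurable_funM.
  apply: measurable_funD => //; apply: measurable_funB => //.
  by apply: measurable_funM => //; exact: measurableT_comp.
have mRN : measurable_fun setT (RN Q lam).
  apply: measurableT_comp => //.
transitivity (\int[lam]_x (g x * ln (g x))%:E)%E.
  apply: ae_eq_integral => //.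
  - apply/measurable_EFinP; apply: measurable_funM => //.
    exact: measurableT_comp.
  - apply/measurable_EFinP; apply: measurable_funM => //.
    exact: measurableT_comp.
  - by apply: filterS RNg => x /(_ I) -> _.
apply: eq_integral => x _; congr EFin.
have [->|gx] := eqVneq (g x) 0; first by rewrite !(mulr0, mul0r); ring.
have gx0 : 0 < g x by rewrite lt0r gx g0.
rewrite lnM ?posrE//; field; by rewrite gt_eqF.
Qed.

End entropy.

(** If the relative entropy term of [Q] is not integrable, its entropy is [-oo]; otherwise [H]
    compares the two terms and the remainders have equal integrals. *)
Lemma maximal_entropy (R : realType) d (T : measurableType d)
    (lam : {sigma_finite_measure set T -> \bar R}) (P0 Q Qmax : probability T R) :
  is_uniform lam P0 -> Q `<< P0 -> Qmax `<< P0 ->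
  (forall f fmax, is_density P0 Q f -> is_density P0 Qmax fmax ->
     P0.-integrable setT (EFin \o (fun x => f x * ln (f x) - f x + 1)) ->
     (\int[P0]_x (fmax x * ln (fmax x) - fmax x + 1)%:E <=
      \int[P0]_x (f x * ln (f x) - f x + 1)%:E)%E) ->
  (entropy lam Q <= entropy lam Qmax)%E.
Proof.
move=> unif QP0 QmP0 H.
have V0 : 0 < fine (lam setT).
  (* For a total mass 0 or infinite, [fine] and its inverse would be 0, and [P0] would have mass
     0. *)
  rewrite lt0r fine_ge0// andbT; apply/eqP => V0.
  have := unif _ measurableT; rewrite V0 invr0 mule0 probability_setT => /eqP.
  by rewrite eqe oner_eq0.
have [f [fd ->]] := entropy_density V0 unif QP0.
have [fm [fmd ->]] := entropy_density V0 unif QmP0.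
set V := fine (lam setT) in V0 *; rewrite leeN2.
have phi_ge0 (h : T -> R) : (forall x, 0 <= h x) ->
    forall x, 0 <= h x * ln (h x) - h x + 1.
  by move=> h0 x; have := gibbs_ineq 0 (h0 x); rewrite mulr0 add0r expR0 subrr.
have mphi (h : T -> R) : measurable_fun setT h ->
    measurable_fun setT (fun x => h x * ln (h x) - h x + 1).
  move=> mh; apply: measurable_funD => //; apply: measurable_funB => //.
  by apply: measurable_funM => //; exact: measurableT_comp.
have icst : P0.-integrable setT (EFin \o (fun=> (1 : R))).
  by apply: bounded_measurable_integrable; exact: bounded_measurable_cst.
have iw Q' h : is_density P0 (Q' : probability T R) h ->
    P0.-integrable setT (EFin \o (fun x => (1 - ln V) * h x - 1)).
  move=> hd; exact: (integrableB measurableT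
    (integrableZl measurableT (1 - ln V) (density_integrable hd)) icst).
have intw Q' h : is_density P0 (Q' : probability T R) h ->
    (\int[P0]_x ((1 - ln V) * h x - 1)%:E = (- ln V)%:E)%E.
  move=> hd; have ih := density_integrable hd.
  rewrite -(fineK (integrable_fin_num measurableT (iw _ _ hd))); congr EFin.
  rewrite -[LHS]/(\int[P0]_x ((1 - ln V) * h x - 1)).
  rewrite RintegralB//; last exact: (integrableZl measurableT (1 - ln V) ih).
  rewrite RintegralZl// Rintegral_probability_cst.
  have -> : \int[P0]_x h x = 1.
    have := Rintegral_density hd (@bounded_measurable_cst _ _ T 1).
    rewrite Rintegral_probability_cst => ->.
    by apply: eq_Rintegral => x _; rewrite mul1r.
  by ring.
have [mf f0 _] := fd; have [mfm fm0 _] := fmd.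
have [iphi|niphi] := pselect (P0.-integrable setT
    (EFin \o (fun x => f x * ln (f x) - f x + 1))); last first.
  rewrite [leRHS](integral_ge0D_nonintegrable (mphi _ mf) (phi_ge0 _ f0)
    niphi (iw _ _ fd)).
  exact: leey.
have le := H f fm fd fmd iphi.
have iphim : P0.-integrable setT
    (EFin \o (fun x => fm x * ln (fm x) - fm x + 1)).
  apply/integrableP; split; first by apply/measurable_EFinP; exact: mphi.
  under eq_integral do rewrite /= ger0_norm ?phi_ge0//.
  apply: le_lt_trans le _; rewrite ltey_eq.
  by rewrite (integrable_fin_num measurableT iphi).
rewrite (integralD_EFin measurableT iphim (iw _ _ fmd)).
rewrite (integralD_EFin measurableT iphi (iw _ _ fd)).
by rewrite (intw _ _ fd) (intw _ _ fmd) leeD2r.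
Qed.

Theorem corollary5p1 (R : realType) (k p : nat) (d : 'I_k -> nat)
    (Lam : set 'rV[R]_p) (x0 : Lam) (mLam : measurable (Lam : set (Rn R p)))
    (D : forall i, set 'rV[R]_(d i)) (y0 : forall i, D i)
    (phi : forall i, {mfun borel x0 >-> borel (y0 i)})
    (Pobs : forall i, probability (borel (y0 i)) R)
    (P0 : probability (borel x0) R)
    (P : nat -> probability (borel x0) R) (Pinf : probability (borel x0) R) :
  (0 < k)%N ->
  precompact Lam ->
  (0 < lebesgue_Rn (Lam : set (Rn R p)))%E ->
  separable_complete_metric R Lam ->
  (forall i, separable_complete_metric R (D i)) ->
  is_uniform (lebesgue_sub x0 mLam) P0 ->
  (exists Q, feasible phi Pobs P0 Q /\ Q `<< P0) ->
  (ereal_inf [set KL Q P0 | Q in feasible phi Pobs P0] < +oo)%E ->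
  bounded_ratios phi Pobs P0 ->
  DCI_sequence phi Pobs P0 P ->
  tv_cvg P Pinf ->
  feasible phi Pobs P0 Pinf /\
  forall Q, feasible phi Pobs P0 Q ->
    (entropy (lebesgue_sub x0 mLam) Q <= entropy (lebesgue_sub x0 mLam) Pinf)%E.
Proof.
move=> k0 _ _ _ metD unif _ _ bdd DCI PPinf.
have mpt i (w : borel (y0 i)) : measurable [set w].
  exact: singleton_measurable (metD i).
have feas := DCI_limit_feasible k0 mpt bdd DCI PPinf.
have ac Q : feasible phi Pobs P0 Q -> Q `<< P0.
  by move=> /(_ (Ordinal k0) I)[].
split=> // Q fQ; apply: (maximal_entropy unif (ac Q fQ) (ac Pinf feas)).
by move=> f finf fd infd; exact: DCI_limit_projection PPinf _ _ _ fQ fd infd.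
Qed.
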